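(* A partial function $F:\subseteq\mathbb{N}^{\mathbb{N}}\to\mathbb{N}^{\mathbb{N}}$ is computable relative to the halting problem if and only if $F\circ G$ is limit computable for every limit computable $G:\subseteq\mathbb{N}^{\mathbb{N}}\to\mathbb{N}^{\mathbb{N}}$.
   Context: $F:\subseteq A\to B$ denotes a partial function, and compositions have their natural domain $\mathrm{dom}(F\circ G)=\{p\in\mathrm{dom}(G):G(p)\in\mathrm{dom}(F)\}$. Coding: $\langle p,q\rangle(2n):=p(n)$, $\langle p,q\rangle(2n+1):=q(n)$ for $p,q\in\mathbb{N}^{\mathbb{N}}$. A partial function $F:\subseteq\mathbb{N}^{\mathbb{N}}\to\mathbb{N}^{\mathbb{N}}$ is computable if there is a Turing machine (infinite input tape, one-way output tape) that on each input $p\in\mathrm{dom}(F)$ produces $F(p)$ in the long run; nothing is required outside $\mathrm{dom}(F)$. $F$ is computable relative to $q\in\mathbb{N}^{\mathbb{N}}$ if there is a computable $G$ with $F(p)=G\langle q,p\rangle$ for all $p\in\mathrm{dom}(F)$. $F$ is limit computable if there is a Turing machine with a two-way output tape (it may revise its output) that on each input $p\in\mathrm{dom}(F)$ computes $F(p)$ in the long run such that for every output position $n\in\mathbb{N}$, after finitely many steps the content of that position is $F(p)(n)$ and is never changed again; nothing is required outside $\mathrm{dom}(F)$. The Turing jump $\mathsf{J}:\mathbb{N}^{\mathbb{N}}\to\mathbb{N}^{\mathbb{N}}$ is defined by $\mathsf{J}(p)(i)=1$ if the $i$-th Turing machine halts upon input $p$, and $0$ otherwise. The halting problem is $0':=\mathsf{J}(000\dots)$.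 *)

(* Defs.v *)
From HB Require Import structures.
From mathcomp Require Import all_boot.
From mathcomp Require Import boolp.

Set Implicit Arguments.
Unset Strict Implicit.
Unset Printing Implicit Defensive.

Definition baire : Type := nat -> nat.

(* A partial function is undefined at p when its value there is [None]. *)
Definition pfun : Type := baire -> option baire.

(* [obind] gives the composition its natural domain. *)
Definition pcomp (F G : pfun) : pfun := fun p => obind F (G p).

Definition join (p q : baire) : baire :=
  fun n => if odd n then q n./2 else p n./2.

(** * Turing machines

    Deterministic machines with a read-only input tape, finitely many work
    tapes and an output tape.  All tapes have cells indexed by [nat].  States
    and symbols are natural numbers, but a machine is a finite list of rules,
    so that it only uses finitely many of them. *)

Inductive direction := Left | Stay | Right.

Definition dir_code (d : direction) : option bool :=
  match d with Left => Some false | Stay => None | Right => Some true end.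
Definition dir_decode (o : option bool) : direction :=
  match o with Some false => Left | None => Stay | Some true => Right end.
Lemma dir_codeK : cancel dir_code dir_decode. Proof. by case. Qed.
HB.instance Definition _ := Countable.copy direction (can_type dir_codeK).

Definition action : Type := nat * direction.

Record rule (k : nat) := Rule {
  src_state : nat;
  read_input : nat;
  read_work : k.-tuple nat;
  read_output : nat;
  dst_state : nat;
  move_input : direction;
  act_work : k.-tuple action;
  act_output : action }.

Definition rule_code k (r : rule k) :=
  (src_state r, read_input r, read_work r, read_output r,
   (dst_state r, move_input r, act_work r, act_output r)).
Definition rule_decode k
    (x : nat * nat * k.-tuple nat * nat *
         (nat * direction * k.-tuple action * action)) : rule k :=
  let: (q, i, w, o, (q', i', w', o')) := x in Rule q i w o q' i' w' o'.
Lemma rule_codeK k : cancel (@rule_code k) (@rule_decode k).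
Proof. by case. Qed.
HB.instance Definition _ k := Countable.copy (rule k) (can_type (@rule_codeK k)).

Record machine := Machine { work_tapes : nat; rules : seq (rule work_tapes) }.

Definition machine_code (M : machine) : {k : nat & seq (rule k)} :=
  Tagged (fun k => seq (rule k)) (rules M).
Definition machine_decode (x : {k : nat & seq (rule k)}) : machine :=
  Machine (tagged x).
Lemma machine_codeK : cancel machine_code machine_decode. Proof. by case. Qed.
HB.instance Definition _ := Countable.copy machine (can_type machine_codeK).

(* [pickle] is an effective injective numbering of machines; the numbers that
   are not codes are assigned the machine without rules. *)
Definition nth_machine (i : nat) : machine :=
  odflt (@Machine 0 [::]) (unpickle i).

(** * Tapes *)

Definition blank : nat := 0.
Definition stroke : nat := 1.
Definition separator : nat := 2.

(* The number n is written as n strokes followed by a separator. *)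
Definition write_numbers (s : seq nat) : seq nat :=
  flatten [seq rcons (nseq n stroke) separator | n <- s].

(* Each number occupies at least one cell, so that the first i.+1 values of p
   determine the content of cell i. *)
Definition input_tape (p : baire) : nat -> nat :=
  fun i => nth blank (write_numbers (mkseq p i.+1)) i.

(* The n-th number written on the tape (counting from 0) is m: the tape starts
   with n numbers followed by m. *)
Definition holds_at (cells : nat -> nat) (n m : nat) : Prop :=
  exists s : seq nat, size s = n /\
    let w := write_numbers (rcons s m) in
    forall i, i < size w -> cells i = nth blank w i.

Record tape := Tape { head : nat; cells : nat -> nat }.

Definition blank_tape : tape := Tape 0 (fun=> blank).

Definition scanned (t : tape) : nat := cells t (head t).

Definition move_head (d : direction) (h : nat) : nat :=
  match d with Left => h.-1 | Stay => h | Right => h.+1 end.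

Definition act (a : action) (t : tape) : tape :=
  Tape (move_head a.2 (head t))
       (fun i => if i == head t then a.1 else cells t i).

(** * Runs *)

Record config (k : nat) := Config {
  state : nat;
  input_head : nat;
  work : k.-tuple tape;
  output : tape }.

Definition initial k : config k :=
  Config 0 0 [tuple of nseq k blank_tape] blank_tape.

Definition applies k (p : baire) (c : config k) (r : rule k) : bool :=
  [&& src_state r == state c,
      read_input r == input_tape p (input_head c),
      read_work r == [tuple of map scanned (work c)] &
      read_output r == scanned (output c)].

Definition apply_rule k (r : rule k) (c : config k) : config k :=
  Config (dst_state r)
         (move_head (move_input r) (input_head c))
         [tuple of [seq act x.1 x.2 | x <- zip (act_work r) (work c)]]
         (act (act_output r) (output c)).

(* The first applicable rule in the list is used. *)
Definition current_rule (M : machine) (p : baire)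
    (c : config (work_tapes M)) : option (rule (work_tapes M)) :=
  ohead [seq r <- rules M | applies p c r].

Definition step (M : machine) (p : baire) (c : config (work_tapes M)) :
    config (work_tapes M) :=
  if current_rule p c is Some r then apply_rule r c else c.

Definition run (M : machine) (p : baire) (t : nat) : config (work_tapes M) :=
  iter t (step p) (initial (work_tapes M)).

Definition halts (M : machine) (p : baire) : Prop :=
  exists t, current_rule p (run M p t) = None.

Definition output_at (M : machine) (p : baire) (t n m : nat) : Prop :=
  holds_at (cells (output (run M p t))) n m.

(* The head of a one-way output tape never moves left, and it moves right
   whenever the machine changes the content of the scanned cell. *)
Definition one_way (M : machine) : bool :=
  all (fun r => ((act_output r).2 == Right) ||
                (act_output r == (read_output r, Stay))) (rules M).

(** * Computability on Baire space *)

Definition computable (F : pfun) : Prop :=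
  exists M : machine, one_way M /\
    forall p r, F p = Some r -> forall n, exists t, output_at M p t n (r n).

Definition computable_relative_to (q : baire) (F : pfun) : Prop :=
  exists G : pfun, computable G /\
    forall p r, F p = Some r -> G (join q p) = Some r.

Definition limit_computable (F : pfun) : Prop :=
  exists M : machine,
    forall p r, F p = Some r -> forall n,
      exists t0, forall t, t0 <= t -> output_at M p t n (r n).

Definition jump (p : baire) : baire := fun i => `[< halts (nth_machine i) p >].

Definition halting_problem : baire := jump (fun=> 0).

(* Main.v *)
(* Computability is reduced to functions on finite strings: a computable
   [a : seq nat -> nat -> nat] applied to longer and longer prefixes of the input
   yields a limit machine if its values converge, and a one-way machine if they
   are either 0 (not yet known) or r(n) + 1.  Conversely, a machine run for [t]
   steps only depends on the first [t] values of its input.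

   If F is computed from 0' by M and G is limit computed by N, run M for s steps
   on the approximations to 0' and G(x) available at stage s; since M never
   revises its output, this converges to F(G(x)).

   For the converse, read a sequence of natural numbers as events "set position
   k to the value v", and let G map a sequence to its limit.  Let M limit compute
   F o G.  If w is a finite string whose final values agree with p below k, and no
   extension of w by events on positions >= k changes the n-th output of M, then
   extending w by the events (j, p(j)) with j >= k shows that this output is
   F(p)(n).  Such a w exists: otherwise, alternating extensions that change the
   n-th output with the events (j, p(j)) gives a sequence with limit p on which
   that output does not converge.  Whether w is of this kind is a question to 0'
   about a machine computed from (w, k, n), so that 0' and p suffice to search
   for w. *)

Require Import Defs.
From HB Require Import structures.
From mathcomp Require Import all_boot.
From mathcomp Require Import boolp zify.

Set Implicit Arguments.
Unset Strict Implicit.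
Unset Printing Implicit Defensive.

(** * Counter machines *)

(** The model is concrete and the halting problem refers to one fixed numbering, so every machine
    that the argument needs is really built. Functions between countable types are shown computable
    on their pickles by counter programs, and a program becomes a machine with one work tape per
    counter. Two machine schemes, one for each kind of output, turn approximations into machines;
    the limit scheme has to come back to every output cell infinitely often. Approximating 0' needs
    a simulator that starts from a machine number, hence the decoding of [pickle]. Asking 0' about
    given data needs the reverse: the number of a machine with the data built in, computed from the
    data.

    The bound k balances two demands. Forbidding events below k forces the alternating sequence to
    converge, since position j is left alone from stage j + 1 on. Leaving the positions from k on
    free lets w be continued towards any p that agrees with it below k, so a finite part of p
    suffices to certify an output. *)

Inductive op :=
| Nop
| Inc (x : nat)
| Dec (x : nat)
| Scan (x y z : nat)
| Back (x : nat)
| Emit (x y z : nat)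
| Fwd (x y : nat)
| Bwd (x : nat).

(** Each operation is what a single machine rule can do. A head cannot recognise the left end of the
    input or output tape, so the operations that move such a head also update a counter that can
    mirror its position. *)
Definition op_moves (o : op) (z : nat -> bool) (i : nat) : seq (nat * direction) :=
  match o with
  | Nop => [::]
  | Inc x => [:: (x, Right)]
  | Dec x | Back x | Bwd x => [:: (x, Left)]
  | Scan x y w => [:: if i == stroke then (x, Right) else (y, Left); (w, Right)]
  | Emit x y w => if z x && z y then [::] else [:: (w, Right)]
  | Fwd x y => [:: (x, Left); (y, Right)]
  end.

Fixpoint lookup (ms : seq (nat * direction)) (r : nat) : direction :=
  if ms is m :: ms' then if r == m.1 then m.2 else lookup ms' r else Stay.

Definition op_input (o : op) : direction :=
  match o with Scan _ _ _ => Right | Back _ => Left | _ => Stay end.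

Definition op_output (o : op) (z : nat -> bool) (a : nat) : action :=
  match o with
  | Emit x y w => if ~~ z x then (stroke, Right)
                  else if ~~ z y then (separator, Right) else (a, Stay)
  | Fwd _ _ => (a, Right)
  | Bwd _ => (a, Left)
  | _ => (a, Stay)
  end.

Definition op_bound (k : nat) (o : op) : bool :=
  match o with
  | Nop => true
  | Inc x | Dec x | Back x | Bwd x => x < k
  | Scan x y w | Emit x y w => [&& x < k, y < k & w < k]
  | Fwd x y => (x < k) && (y < k)
  end.

Definition op_one_way (o : op) : bool := if o is Bwd _ then false else true.

Record store := Store { regs : nat -> nat; ipos : nat; out : tape }.

Definition zeros (s : store) : nat -> bool := fun r => regs s r == 0.

Definition exec_op (p : baire) (o : op) (s : store) : store :=
  Store (fun r => move_head (lookup (op_moves o (zeros s) (input_tape p (ipos s))) r)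
                            (regs s r))
        (move_head (op_input o) (ipos s))
        (act (op_output o (zeros s) (scanned (out s))) (out s)).

(** The test of counter [itest] sees the counters before [iop] acts, because one machine rule
    decides both. *)
Record instr := Instr { iop : op; itest : nat; izero : nat; inonzero : nat }.

Definition instr_bound k i := op_bound k (iop i) && (itest i < k).

Definition next_addr (i : instr) (z : nat -> bool) :=
  if z (itest i) then izero i else inonzero i.

(* Addresses outside the code and addresses holding [None] are halting. *)
Definition code := seq (option instr).

Definition code_next (C : code) (p : baire) (c : nat * store) :
    option (nat * store) :=
  omap (fun i => (next_addr i (zeros c.2), exec_op p (iop i) c.2)) (nth None C c.1).

Definition code_step C p c := odflt c (code_next C p c).

Definition init_store : store := Store (fun=> 0) 0 blank_tape.

Section MachineOf.

Variables (k : nat) (C : code) (start : nat).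

(* [w] tells which counters are zero; the value n of a counter is represented by
   the head position on a work tape whose only nonblank cell is cell 0. *)
Definition instr_rule (a : nat) (i : instr) (x : nat * k.-tuple bool * nat) :
    rule k :=
  let: (inp, w, o) := x in
  let z := nth false w in
  @Rule k a.+1 inp [tuple of map nat_of_bool w] o (next_addr i z).+1
    (op_input (iop i))
    [tuple (nat_of_bool (tnth w j), lookup (op_moves (iop i) z inp) j) | j < k]
    (op_output (iop i) z o).

(** By [input_tapeE] the input tape carries no blank, so these are all the readings that can
    occur. *)
Definition readings : seq (nat * k.-tuple bool * nat) :=
  [seq (x, o) | x <- [seq (inp, w) | inp <- [:: stroke; separator],
                                     w <- enum {: k.-tuple bool}],
                o <- [:: blank; stroke; separator]].

Definition instr_rules (a : nat) (i : option instr) : seq (rule k) :=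
  if i is Some i then [seq instr_rule a i x | x <- readings] else [::].

(** State 0 is reserved for marking cell 0 of every work tape, which makes a counter testable for
    zero; hence address a is represented by state a + 1. *)
Definition mark_rule (inp : nat) : rule k :=
  @Rule k 0 inp [tuple of nseq k blank] blank start.+1 Stay
    [tuple of nseq k (stroke, Stay)] (blank, Stay).

Definition code_rules (C : code) :=
  flatten [seq instr_rules a (nth None C a) | a <- iota 0 (size C)].

Definition machine_of : machine :=
  @Machine k ([seq mark_rule inp | inp <- [:: stroke; separator]] ++ code_rules C).

Definition counter_tape (n : nat) : tape := Tape n (fun j => j == 0).

Definition config_of (c : nat * store) : config k :=
  @Config k c.1.+1 (ipos c.2) [tuple counter_tape (regs c.2 j) | j < k] (out c.2).

End MachineOf.

Definition code_bound k (C : code) := all (fun i => oapp (instr_bound k) true i) C.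

Definition code_one_way (C : code) := all (fun i => oapp (op_one_way \o iop) true i) C.

Lemma ohead_filter_uniq (T : eqType) (P : pred T) (s : seq T) x :
  x \in s -> P x -> (forall y, y \in s -> P y -> y = x) ->
  ohead (filter P s) = Some x.
Proof.
move=> xs Px uni; case E: (filter P s) => [|y s'] /=.
  by move: (mem_filter P x s); rewrite E xs Px.
by congr Some; apply: uni; have := mem_filter P y s; rewrite E mem_head => /esym/andP[].
Qed.

Lemma input_tapeE p i :
  (input_tape p i == stroke) || (input_tape p i == separator).
Proof.
have all12 : all (fun a => (a == stroke) || (a == separator)) (write_numbers (mkseq p i.+1)).
  rewrite /write_numbers; elim: (mkseq _ _) => //= n s IH.
  by rewrite all_cat IH all_rcons all_nseq /= orbT.
apply: (allP all12); rewrite mem_nth //.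
rewrite /write_numbers size_flatten /shape -map_comp.
suff H n : n <= sumn [seq (size \o (fun n => rcons (nseq n stroke) separator)) x
                     | x <- mkseq p n].
  exact: H.
elim: n => // n IH.
by rewrite mkseqS map_rcons sumn_rcons /= size_rcons
  addnS ltnS (leq_trans IH) ?leq_addr.
Qed.

Lemma tnth_act k (a : k.-tuple action) (t : k.-tuple tape) j :
  tnth [tuple of [seq act x.1 x.2 | x <- zip a t]] j = act (tnth a j) (tnth t j).
Proof.
rewrite tnth_map !(tnth_nth blank_tape) (tnth_nth ((0, Stay), blank_tape)).
by rewrite nth_zip ?size_tuple //= (tnth_nth (0, Stay)).
Qed.

Section Lockstep.

Variables (k : nat) (C : code) (start : nat) (p : baire).
Hypothesis Ck : code_bound k C.

Let M := machine_of k C start.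

Lemma mem_readings x :
  (x \in readings k) = ((x.1.1 == stroke) || (x.1.1 == separator)) && (x.2 < 3).
Proof.
case: x => -[i w] o; apply/allpairsP/idP.
  case=> -[x' o'] [/allpairsP[[i1 w1] [H1 _ ->]] H2 /= [-> _ ->]].
  by move: H1 H2; rewrite !inE /= => -> /or3P[]/eqP->.
case/andP=> Hi Ho; exists ((i, w), o); split; [ | | by []].
  by apply: allpairs_f; rewrite ?mem_enum // !inE.
by case: o Ho {Hi} => [|[|[|]]].
Qed.

Lemma mem_code_rules (r : rule k) :
  reflect (exists a i x, [/\ nth None C a = Some i, x \in readings k &
                             r = instr_rule a i x])
          (r \in code_rules k C).
Proof.
apply: (iffP flatten_mapP) => [[a]|[a [i [x [Ea xr ->]]]]].
  rewrite mem_iota /instr_rules; case E: (nth None C a) => [i|] // _ /mapP[x xr ->].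
  by exists a, i, x.
exists a; last by rewrite Ea; apply: map_f.
by rewrite mem_iota /=; case: ltnP => // /(nth_default None); rewrite Ea.
Qed.

Definition zero_word (s : store) : k.-tuple bool := [tuple zeros s j | j < k].

Lemma zero_wordE s r : r < k -> nth false (zero_word s) r = zeros s r.
Proof. by move=> rk; rewrite -[r]/(val (Ordinal rk)) -tnth_nth tnth_mktuple. Qed.

Lemma scanned_counters s :
  [tuple of map scanned [tuple counter_tape (regs s j) | j < k]]
  = [tuple of map nat_of_bool (zero_word s)] :> k.-tuple nat.
Proof. by apply: eq_from_tnth => j; rewrite !tnth_map. Qed.

Lemma nat_of_bool_word_inj (w w' : k.-tuple bool) :
  [tuple of map nat_of_bool w] = [tuple of map nat_of_bool w'] -> w = w'.
Proof.
move=> /(congr1 val) /= H; apply: val_inj; apply: (inj_map _ H).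
by do 2!case.
Qed.

Lemma op_moves_word o s i r : op_bound k o -> r < k ->
  lookup (op_moves o (nth false (zero_word s)) i) r = lookup (op_moves o (zeros s) i) r.
Proof. by case: o => //= x y z /and3P[xk yk zk] rk; rewrite !zero_wordE. Qed.

Lemma op_output_word o s a : op_bound k o ->
  op_output o (nth false (zero_word s)) a = op_output o (zeros s) a.
Proof. by case: o => //= x y z /and3P[xk yk zk]; rewrite !zero_wordE. Qed.

Lemma instr_boundP a i : nth None C a = Some i -> instr_bound k i.
Proof.
move=> E; have aC : a < size C by case: ltnP => // /(nth_default None); rewrite E.
by have := all_nthP None Ck a aC; rewrite E.
Qed.

(** The source state fixes the address and the reading fixes the rest, so no two different rules
    apply. The bound 3 ensures that some rule expects the scanned output symbol. *)
Lemma current_rule_code c : scanned (out c.2) < 3 ->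
  @current_rule M p (config_of k c) =
  omap (fun i => instr_rule c.1 i
    (input_tape p (ipos c.2), zero_word c.2, scanned (out c.2))) (nth None C c.1).
Proof.
case: c => a s /= Hs.
have Huniq r : r \in rules M -> applies p (config_of k (a, s)) r ->
    exists2 i, nth None C a = Some i &
      r = instr_rule a i (input_tape p (ipos s), zero_word s, scanned (out s)).
  rewrite /= !inE => /or3P[/eqP->|/eqP->|]; rewrite /applies /= //.
  case/mem_code_rules => b [i [[[inp w] o] [Eb _ ->]]] /=.
  rewrite eqSS => /and4P[/eqP ba /eqP<- /eqP + /eqP<-].
  rewrite scanned_counters => /nat_of_bool_word_inj Ew.
  by exists i; rewrite -ba //; subst w.
rewrite /current_rule; case E: (nth None C a) => [i|] /=.
  apply: ohead_filter_uniq.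
  - apply/mem_code_rules; exists a, i, (input_tape p (ipos s), zero_word s, scanned (out s)).
    split; [by []| |by []].
    by rewrite mem_readings /= input_tapeE Hs.
  - by rewrite /applies /= !eqxx /= scanned_counters eqxx.
  move=> r rM; case/Huniq => [|i']; last by rewrite E => -[<-].
  by rewrite /= !inE rM !orbT.
case F: filter => [|r l] //=.
have : r \in filter (applies p (config_of k (a, s))) (code_rules k C) by rewrite F mem_head.
rewrite mem_filter => /andP[ar rC].
have rM : r \in rules M by rewrite /= !inE rC !orbT.
by have [i'] := Huniq _ rM ar; rewrite E.
Qed.

Lemma step_config_of c : scanned (out c.2) < 3 ->
  @step M p (config_of k c) = config_of k (code_step C p c).
Proof.
move=> Hs; rewrite /step current_rule_code // /code_step /code_next.
case: c Hs => a s /= Hs; case E: (nth None C a) => [i|] //=.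
have /andP[ok tk] := instr_boundP E.
rewrite /apply_rule /config_of /=; congr Config.
- by rewrite /next_addr zero_wordE.
- apply: eq_from_tnth => j; rewrite tnth_mktuple.
  rewrite (tnth_act [tuple _ | _ < k] [tuple _ | _ < k]) !tnth_mktuple.
  rewrite /act /counter_tape /= op_moves_word //; congr Tape.
  apply/funext => n; case: ifP => // /eqP ->; by rewrite /zeros; case: (regs s j).
- by rewrite op_output_word.
Qed.

Lemma code_step_symbols c n : (forall j, cells (out c.2) j < 3) ->
  forall j, cells (out (iter n (code_step C p) c).2) j < 3.
Proof.
elim: n => //= n IH Hc; move: (IH Hc); case: (iter n _ c) => a s /= H.
rewrite /code_step /code_next /=; case E: (nth None C a) => [i|] //= j.
case: ifP => // _; rewrite /scanned.
by case: (iop i) => * /=; rewrite ?H //; do 2?case: ifP => _; rewrite /= ?H.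
Qed.

(** The first machine step is spent on [mark_rule]; from then on one instruction corresponds to one
    machine step. *)
Lemma run_machine_of t :
  run M p t.+1 = config_of k (iter t (code_step C p) (start, init_store)).
Proof.
elim: t => [|t IH]; last first.
  rewrite /run iterS -/(run M p t.+1) IH iterS step_config_of //.
  exact: (@code_step_symbols (start, init_store)).
rewrite /run /= /step.
have := @ohead_filter_uniq _ (applies p (initial k)) (rules M)
  (@mark_rule k start (input_tape p 0)).
rewrite /current_rule => ->.
- rewrite /apply_rule /config_of /=; congr Config.
  + apply: eq_from_tnth => j; rewrite tnth_mktuple.
    rewrite (tnth_act [tuple of nseq k _] [tuple of nseq k _]) !tnth_nseq /act /=.
    congr Tape; by apply/funext => -[].
  + rewrite /act /blank_tape /=; congr Tape; by apply/funext => -[].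
- rewrite /= !inE; have /orP[/eqP->|/eqP->] := input_tapeE p 0; rewrite eqxx ?orbT //.
- rewrite /applies /= !eqxx /= andbT; apply/eqP; apply: eq_from_tnth => j.
  by rewrite tnth_map !tnth_nseq.
move=> r; rewrite /= !inE => /or3P[/eqP->|/eqP->|].
- by rewrite /applies /= => /and3P[/eqP -> _ _].
- by rewrite /applies /= => /and3P[/eqP -> _ _].
by case/mem_code_rules => b [i [[[inp w] o] [Eb _ ->]]] /=.
Qed.

Lemma halts_machine_of :
  halts M p <-> exists t, code_next C p (iter t (code_step C p) (start, init_store)) = None.
Proof.
have H t : @current_rule M p (run M p t.+1) = None <->
    code_next C p (iter t (code_step C p) (start, init_store)) = None.
  rewrite run_machine_of current_rule_code; last exact: (@code_step_symbols (start, init_store)).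
  by rewrite /code_next; case: nth.
split=> [[t Ht]|[t]]; last by exists t.+1; apply/H.
(* A configuration without applicable rule is left unchanged by [step], so the halting time may be
   increased by one to fit the shift. *)
exists t; apply/H.
by rewrite /run iterS -/(run M p t) /step Ht.
Qed.

Lemma output_at_machine_of t n m :
  output_at M p t.+1 n m <->
  holds_at (cells (out (iter t (code_step C p) (start, init_store)).2)) n m.
Proof. by rewrite /output_at run_machine_of. Qed.

End Lockstep.

Lemma one_way_machine_of k C start : code_one_way C -> one_way (machine_of k C start).
Proof.
move=> CC; rewrite /one_way /= ; apply/allP => r /mem_code_rules[a [i [[[inp w] o] [Ea _ ->]]]] /=.
have aC : a < size C by case: ltnP => // /(nth_default None); rewrite Ea.
have := all_nthP None CC a aC; rewrite Ea /=.
case: (iop i) => //= *; rewrite ?eqxx ?orbT //.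
by do 2?case: ifP; rewrite ?eqxx ?orbT.
Qed.

(** * Structured programs *)

Inductive cmd :=
| Do (o : op)
| Seq (c1 c2 : cmd)
| If (x : nat) (c1 c2 : cmd)
| While (x : nat) (c : cmd).

Fixpoint cmd_size (c : cmd) : nat :=
  match c with
  | Do _ => 1
  | Seq c1 c2 => cmd_size c1 + cmd_size c2
  | If _ c1 c2 => (cmd_size c1 + cmd_size c2).+1
  | While _ c => (cmd_size c).+1
  end.

(* The code of [c] to be placed at address [a] and continuing at address [e]. *)
Fixpoint compile (c : cmd) (a e : nat) : code :=
  match c with
  | Do o => [:: Some (Instr o 0 e e)]
  | Seq c1 c2 => compile c1 a (a + cmd_size c1) ++ compile c2 (a + cmd_size c1) e
  | If x c1 c2 => Some (Instr Nop x (a.+1 + cmd_size c1) a.+1) ::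
      compile c1 a.+1 e ++ compile c2 (a.+1 + cmd_size c1) e
  | While x c => Some (Instr Nop x e a.+1) :: compile c a.+1 a
  end.

Lemma size_compile c a e : size (compile c a e) = cmd_size c.
Proof.
elim: c a e => //= [c1 IH1 c2 IH2|x c1 IH1 c2 IH2|x c IH] a e.
- by rewrite size_cat IH1 IH2.
- by rewrite size_cat IH1 IH2.
- by rewrite IH.
Qed.

Fixpoint cmd_bound k (c : cmd) : bool :=
  match c with
  | Do o => op_bound k o
  | Seq c1 c2 => cmd_bound k c1 && cmd_bound k c2
  | If x c1 c2 => [&& x < k, cmd_bound k c1 & cmd_bound k c2]
  | While x c => (x < k) && cmd_bound k c
  end.

(** A positive k is required because [Do] compiles to an instruction with a dummy test of counter
    0. *)
Lemma code_bound_compile k c a e : 0 < k -> cmd_bound k c -> code_bound k (compile c a e).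
Proof.
rewrite /code_bound => k0; elim: c a e => //= [o|c1 IH1 c2 IH2|x c1 IH1 c2 IH2|x c IH] a e.
- by move=> ok; rewrite /instr_bound /= k0 ok.
- by case/andP=> /IH1 H1 /IH2 H2; rewrite all_cat H1 H2.
- by case/and3P=> xk /IH1 H1 /IH2 H2; rewrite all_cat H1 H2 /instr_bound /= xk.
- by case/andP=> xk /IH H; rewrite H /instr_bound /= xk.
Qed.

Lemma op_boundS k k' o : k <= k' -> op_bound k o -> op_bound k' o.
Proof.
move=> kk; have H x : x < k -> x < k' by move=> /leq_trans; apply.
case: o => //= *; repeat match goal with
 H : is_true (_ && _) |- _ => case/andP: H => * end; by rewrite ?andbT !H.
Qed.

Lemma cmd_boundS k k' c : k <= k' -> cmd_bound k c -> cmd_bound k' c.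
Proof.
move=> kk; have H x : x < k -> x < k' by move=> /leq_trans; apply.
elim: c => //= [o|c1 IH1 c2 IH2|x c1 IH1 c2 IH2|x c IH].
- exact: op_boundS.
- by case/andP=> /IH1 -> /IH2.
- by case/and3P=> /H -> /IH1 -> /IH2.
- by case/andP=> /H -> /IH.
Qed.

Lemma cmd_bound_ex c : exists2 k, 0 < k & cmd_bound k c.
Proof.
elim: c => [o|c1 [k1 k10 H1] c2 [k2 k20 H2]|x c1 [k1 k10 H1] c2 [k2 k20 H2]|x c [k k0 H]].
- case: o => [|x|x|x y z|x|x y z|x y|x];
    [by exists 1|exists x.+1|exists x.+1|exists (x + y + z).+1|exists x.+1|
     exists (x + y + z).+1|exists (x + y).+1|exists x.+1] => //=; lia.
- exists (maxn k1 k2); first lia.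
  by rewrite /= !(cmd_boundS _ H1, cmd_boundS _ H2); lia.
- exists (maxn x.+1 (maxn k1 k2)); first lia.
  by rewrite /= !(cmd_boundS _ H1, cmd_boundS _ H2); lia.
- exists (maxn x.+1 k); first lia.
  by rewrite /= !(cmd_boundS _ H); lia.
Qed.

Fixpoint cmd_one_way (c : cmd) : bool :=
  match c with
  | Do o => op_one_way o
  | Seq c1 c2 => cmd_one_way c1 && cmd_one_way c2
  | If x c1 c2 => cmd_one_way c1 && cmd_one_way c2
  | While x c => cmd_one_way c
  end.

Lemma code_one_way_compile c a e : cmd_one_way c -> code_one_way (compile c a e).
Proof.
rewrite /code_one_way; elim: c a e => //= [o|c1 IH1 c2 IH2|x c1 IH1 c2 IH2|x c IH] a e.
- by move=> ->.
- by case/andP=> /IH1 H1 /IH2 H2; rewrite all_cat H1 H2.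
- by case/andP=> /IH1 H1 /IH2 H2; rewrite all_cat H1 H2.
- exact: IH.
Qed.

(* [Q] is required of the output tape throughout the execution. *)
Inductive exec (p : baire) (Q : tape -> Prop) : cmd -> store -> store -> Prop :=
| exec_Do o s : Q (out (exec_op p o s)) -> exec p Q (Do o) s (exec_op p o s)
| exec_Seq c1 c2 s1 s2 s3 :
    exec p Q c1 s1 s2 -> exec p Q c2 s2 s3 -> exec p Q (Seq c1 c2) s1 s3
| exec_If1 x c1 c2 s s' :
    regs s x <> 0 -> exec p Q c1 s s' -> exec p Q (If x c1 c2) s s'
| exec_If0 x c1 c2 s s' :
    regs s x = 0 -> exec p Q c2 s s' -> exec p Q (If x c1 c2) s s'
| exec_While0 x c s : regs s x = 0 -> exec p Q (While x c) s s
| exec_While1 x c s1 s2 s3 : regs s1 x <> 0 ->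
    exec p Q c s1 s2 -> exec p Q (While x c) s2 s3 -> exec p Q (While x c) s1 s3.

Lemma exec_out p Q c s s' : exec p Q c s s' -> Q (out s) -> Q (out s').
Proof.
by elim=> //= {c s s'} [c1 c2 s1 s2 s3 _ H1 _ H2 /H1/H2|x c s1 s2 s3 _ _ H1 _ H2 /H1/H2].
Qed.

Definition code_at (C : code) (a : nat) (D : code) : Prop :=
  forall i, i < size D -> nth None C (a + i) = nth None D i.

Lemma code_at_cat C a D1 D2 :
  code_at C a (D1 ++ D2) -> code_at C a D1 /\ code_at C (a + size D1) D2.
Proof.
move=> H; split=> i Hi.
  by rewrite H ?nth_cat ?Hi // size_cat ltn_addr.
rewrite -addnA H ?size_cat ?ltn_add2l // nth_cat ltnNge leq_addr /=.
by rewrite addKn.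
Qed.

Lemma code_at_cons C a i D :
  code_at C a (i :: D) -> nth None C a = i /\ code_at C a.+1 D.
Proof.
move=> H; split; first by have := H 0; rewrite addn0; apply.
by move=> j Hj; have := H j.+1; rewrite addnS addSn; apply.
Qed.

(** [Q] is demanded at every intermediate configuration, because limit computability speaks about
    all late times and not only about the ends of stages. *)
Definition reach C p (Q : tape -> Prop) (c c' : nat * store) : Prop :=
  exists2 n, c' = iter n (code_step C p) c &
    forall m, m <= n -> Q (out (iter m (code_step C p) c).2).

Lemma reach_trans C p Q c1 c2 c3 :
  reach C p Q c1 c2 -> reach C p Q c2 c3 -> reach C p Q c1 c3.
Proof.
case=> n -> Hn [m -> Hm]; exists (m + n); [by rewrite iterD|].
move=> j jmn; case: (leqP j n) => [/Hn //|nj].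
by rewrite -(subnK (ltnW nj)) iterD; apply: Hm; lia.
Qed.

Lemma reach_step C p (Q : tape -> Prop) c c' :
  Q (out c.2) -> Q (out c'.2) -> code_step C p c = c' -> reach C p Q c c'.
Proof. by move=> H H' E; exists 1 => [//|[|[|]]] //= _; rewrite E. Qed.

Lemma exec_Nop p s : exec_op p Nop s = s.
Proof.
case: s => r i [h f]; rewrite /exec_op /act /= /scanned /=; congr Store; congr Tape.
by apply/funext => j; case: eqP => [->|].
Qed.

Lemma code_step_test C p a x e1 e0 s : nth None C a = Some (Instr Nop x e1 e0) ->
  code_step C p (a, s) = (if regs s x == 0 then e1 else e0, s).
Proof. by rewrite /code_step /code_next /= => ->; rewrite /= exec_Nop. Qed.

Lemma reach_exec C p Q c s s' : exec p Q c s s' -> Q (out s) ->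
  forall a e, code_at C a (compile c a e) -> reach C p Q (a, s) (e, s').
Proof.
elim=> {c s s'} /=.
- move=> o s Qs' Qs a e /code_at_cons[Ca _].
  apply: reach_step => //=; rewrite /code_step /code_next /= Ca /=.
  by rewrite /next_addr /=; case: zeros.
- move=> c1 c2 s1 s2 s3 H1 IH1 H2 IH2 Q1 a e /code_at_cat[]; rewrite size_compile.
  move=> /(IH1 Q1) R1 /(IH2 (exec_out H1 Q1)); exact: reach_trans.
- move=> x c1 c2 s s' /eqP/negbTE sx H1 IH1 Q1 a e /code_at_cons[Ca /code_at_cat[+ _]].
  move=> /(IH1 Q1); apply: reach_trans; apply: reach_step => //.
  by rewrite (code_step_test _ _ Ca) sx.
- move=> x c1 c2 s s' /eqP sx H1 IH1 Q1 a e /code_at_cons[Ca /code_at_cat[_]].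
  rewrite size_compile => /(IH1 Q1); apply: reach_trans; apply: reach_step => //.
  by rewrite (code_step_test _ _ Ca) sx.
- move=> x c s /eqP sx Q1 a e /code_at_cons[Ca _]; apply: reach_step => //.
  by rewrite (code_step_test _ _ Ca) sx.
- move=> x c s1 s2 s3 /eqP/negbTE sx H1 IH1 H2 IH2 Q1 a e H.
  have [Ca /(IH1 Q1) R1] := code_at_cons H.
  apply: reach_trans (IH2 (exec_out H1 Q1) _ _ H).
  apply: reach_trans R1; apply: reach_step => //.
  by rewrite (code_step_test _ _ Ca) sx.
Qed.

(** * Arithmetic by programs *)

Definition scons (x : nat) (r : nat -> nat) : nat -> nat :=
  fun i => if i is j.+1 then r j else x.

Notation "x .: r" := (scons x r) (at level 55, right associativity).

Definition zst : nat -> nat := fun=> 0.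

(** Renaming all counters by one lets a program run above a protected counter 0, so the counters can
    be used like a stack. *)
Definition shift_op (o : op) : op :=
  match o with
  | Nop => Nop
  | Inc x => Inc x.+1
  | Dec x => Dec x.+1
  | Scan x y z => Scan x.+1 y.+1 z.+1
  | Back x => Back x.+1
  | Emit x y z => Emit x.+1 y.+1 z.+1
  | Fwd x y => Fwd x.+1 y.+1
  | Bwd x => Bwd x.+1
  end.

Fixpoint shift (c : cmd) : cmd :=
  match c with
  | Do o => Do (shift_op o)
  | Seq c1 c2 => Seq (shift c1) (shift c2)
  | If x c1 c2 => If x.+1 (shift c1) (shift c2)
  | While x c => While x.+1 (shift c)
  end.

Definition shift_store (y : nat) (s : store) : store :=
  Store (y .: regs s) (ipos s) (out s).

Lemma op_moves_shift o z z' i : (forall x, z' x.+1 = z x) ->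
  op_moves (shift_op o) z' i = [seq (m.1.+1, m.2) | m <- op_moves o z i].
Proof. by move=> Hz; case: o => *; rewrite /= ?Hz //; case: ifP. Qed.

Lemma exec_op_shift p o y s :
  exec_op p (shift_op o) (shift_store y s) = shift_store y (exec_op p o s).
Proof.
have lookup_shift ms j :
    lookup [seq (m.1.+1, m.2) | m <- ms] j = if j is j'.+1 then lookup ms j' else Stay.
  by case: j => [|j]; elim: ms => //= m ms ->; rewrite ?eqSS.
rewrite /exec_op /shift_store; congr Store; last by case: o.
  apply/funext => j; rewrite (@op_moves_shift _ (zeros s)) // lookup_shift.
  by case: j.
by case: o.
Qed.

Lemma exec_shift p Q c s s' y :
  exec p Q c s s' -> exec p Q (shift c) (shift_store y s) (shift_store y s').
Proof.
elim=> {c s s'} /=.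
- by move=> o s Qs; rewrite -exec_op_shift; apply: exec_Do; rewrite exec_op_shift.
- by move=> c1 c2 s1 s2 s3 _ H1 _; apply: exec_Seq.
- by move=> x c1 c2 s s' sx _ H1; apply: exec_If1.
- by move=> x c1 c2 s s' sx _ H1; apply: exec_If0.
- by move=> x c s sx; apply: exec_While0.
- by move=> x c s1 s2 s3 sx _ H1 _; apply: exec_While1.
Qed.

Lemma cmd_one_way_shift c : cmd_one_way (shift c) = cmd_one_way c.
Proof. by elim: c => //= [[]|c1 -> c2 ->|x c1 -> c2 ->]. Qed.

(** Only counters change. Quantifying over [Q] allows such a calculation to be inserted under any
    condition on the output tape. *)
Definition calc (c : cmd) (r r' : nat -> nat) : Prop :=
  forall p Q i t, Q t -> exec p Q c (Store r i t) (Store r' i t).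

Lemma calc_shift c r r' y : calc c r r' -> calc (shift c) (y .: r) (y .: r').
Proof. by move=> H p Q i t Qt; apply: (exec_shift y (H p Q i t Qt)). Qed.

Lemma calc_ext c r r' r1 r1' : r =1 r1 -> r' =1 r1' -> calc c r1 r1' -> calc c r r'.
Proof. by move=> /funext-> /funext->. Qed.

Lemma calc_seq c1 c2 r1 r2 r3 : calc c1 r1 r2 -> calc c2 r2 r3 -> calc (Seq c1 c2) r1 r3.
Proof. by move=> H1 H2 p Q i t Qt; apply: exec_Seq (H1 p Q i t Qt) (H2 p Q i t Qt). Qed.

Lemma calc_if1 x c1 c2 r r' : r x <> 0 -> calc c1 r r' -> calc (If x c1 c2) r r'.
Proof. by move=> rx H p Q i t Qt; apply: exec_If1 => //; apply: H. Qed.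

Lemma calc_if0 x c1 c2 r r' : r x = 0 -> calc c2 r r' -> calc (If x c1 c2) r r'.
Proof. by move=> rx H p Q i t Qt; apply: exec_If0 => //; apply: H. Qed.

Lemma calc_while0 x c r r' : r x = 0 -> r =1 r' -> calc (While x c) r r'.
Proof. by move=> rx /funext<- p Q i t Qt; apply: exec_While0. Qed.

Lemma calc_while1 x c r1 r2 r3 :
  r1 x <> 0 -> calc c r1 r2 -> calc (While x c) r2 r3 -> calc (While x c) r1 r3.
Proof. by move=> rx H1 H2 p Q i t Qt; apply: exec_While1 (H1 p Q i t Qt) (H2 p Q i t Qt). Qed.

Lemma calc_for x c (R : nat -> nat -> nat) n :
  (forall m, R m x = m) -> (forall m, calc c (R m.+1) (R m)) ->
  calc (While x c) (R n) (R 0).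
Proof.
move=> Rx H; elim: n => [|n IH]; first exact: calc_while0.
by apply: calc_while1 (H n) IH; rewrite Rx.
Qed.

Lemma act_stay t : act (scanned t, Stay) t = t.
Proof.
by case: t => h f; rewrite /act /scanned /=; congr Tape; apply/funext => j; case: eqP => [->|].
Qed.

Lemma calc_inc x r r' :
  (forall j, r' j = if j == x then (r j).+1 else r j) -> calc (Do (Inc x)) r r'.
Proof.
move=> H p Q i t Qt; have -> : Store r' i t = exec_op p (Inc x) (Store r i t).
  rewrite /exec_op /= act_stay; congr Store.
  by apply/funext => j; rewrite H; case: eqP.
by apply: exec_Do; rewrite /= act_stay.
Qed.

Lemma calc_dec x r r' :
  (forall j, r' j = if j == x then (r j).-1 else r j) -> calc (Do (Dec x)) r r'.
Proof.
move=> H p Q i t Qt; have -> : Store r' i t = exec_op p (Dec x) (Store r i t).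
  rewrite /exec_op /= act_stay; congr Store.
  by apply/funext => j; rewrite H; case: eqP.
by apply: exec_Do; rewrite /= act_stay.
Qed.

Definition clear x := While x (Do (Dec x)).

Lemma calc_clear x r r' :
  (forall j, r' j = if j == x then 0 else r j) -> calc (clear x) r r'.
Proof.
move=> H; pose R m := fun j => if j == x then m else r j.
suff: calc (clear x) (R (r x)) (R 0).
  by apply: calc_ext => j; rewrite ?H /R; case: eqP => // ->.
apply: calc_for => m; first by rewrite /R eqxx.
by apply: calc_dec => j; rewrite /R; case: eqP.
Qed.

Definition move_reg x y := While x (Seq (Do (Dec x)) (Do (Inc y))).

Lemma calc_move x y r r' : x != y ->
  (forall j, r' j = if j == x then 0 else if j == y then r y + r x else r j) ->
  calc (move_reg x y) r r'.
Proof.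
move=> xy H.
move En: (r x) => n; elim: n => [|n IH] in r r' H En *.
  apply: calc_while0 => // j.
  by rewrite H En addn0; case: eqP => [->|] //; case: eqP => [->|].
pose r1 j := if j == x then (r j).-1 else r j.
pose r2 j := if j == y then (r1 j).+1 else r1 j.
have yx : (y == x) = false by rewrite eq_sym (negbTE xy).
apply: (@calc_while1 _ _ _ r2); first by rewrite En.
  by apply: (@calc_seq _ _ _ r1); [apply: calc_dec|apply: calc_inc].
apply: IH; last by rewrite /r2 /r1 (negbTE xy) eqxx En.
move=> j; rewrite H /r2 /r1 !eqxx yx (negbTE xy) En.
by case: eqP => // _; case: eqP => // _; rewrite addnS addSn.
Qed.

(** Scratch counters end at zero so that programs can be chained; [cmd_one_way] is recorded because
    these programs become parts of one-way machines. *)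
Definition rc (f : nat -> nat) : Prop :=
  exists2 c, cmd_one_way c & forall x, calc c (x .: zst) (f x .: zst).

Lemma rc_succ : rc succn.
Proof. by exists (Do (Inc 0)) => // x; apply: calc_inc => -[|[]]. Qed.

Lemma rc_const0 : rc (fun=> 0).
Proof. by exists (clear 0) => // x; apply: calc_clear => -[|[]]. Qed.

Lemma rc_id : rc id.
Proof.
exists (Do Nop) => // x p Q i t Qt.
by rewrite -[X in exec _ _ _ _ X](exec_Nop p); apply: exec_Do; rewrite exec_Nop.
Qed.

Lemma rc_comp f g : rc f -> rc g -> rc (f \o g).
Proof.
case=> cf of_ Hf [cg og Hg]; exists (Seq cg cf); rewrite /= ?of_ ?og // => x.
exact: calc_seq (Hg x) (Hf _).
Qed.

Definition dup := Seq (While 0 (Seq (Do (Dec 0)) (Seq (Do (Inc 1)) (Do (Inc 2)))))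
                      (move_reg 2 0).

Ltac small_reg := by case=> [|[|[|[|[|?]]]]].

Lemma calc_dup x : calc dup (x .: zst) (x .: x .: zst).
Proof.
suff H n a b : calc (While 0 (Seq (Do (Dec 0)) (Seq (Do (Inc 1)) (Do (Inc 2)))))
    (n .: a .: b .: zst) (0 .: a + n .: b + n .: zst).
  apply: (@calc_seq _ _ _ (0 .: x .: x .: zst)); last first.
    by apply: calc_move => //; small_reg.
  by move: (H x 0 0); apply: calc_ext; small_reg.
elim: n a b => [|n IH] a b; first by rewrite !addn0; apply: calc_while0.
apply: (@calc_while1 _ _ _ (n .: a.+1 .: b.+1 .: zst)) => //; last first.
  by rewrite -!addSnnS; apply: IH.
apply: (@calc_seq _ _ _ (n .: a .: b .: zst)); first by apply: calc_dec; small_reg.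
apply: (@calc_seq _ _ _ (n .: a.+1 .: b .: zst)); apply: calc_inc; small_reg.
Qed.

Definition swap := Seq (move_reg 0 2) (Seq (move_reg 1 0) (move_reg 2 1)).

Lemma calc_swap x y : calc swap (x .: y .: zst) (y .: x .: zst).
Proof.
apply: (@calc_seq _ _ _ (0 .: y .: x .: zst)); first by apply: calc_move => //; small_reg.
by apply: (@calc_seq _ _ _ (y .: 0 .: x .: zst)); apply: calc_move => //; small_reg.
Qed.

(** This is the step of [CodeSeq.code]: it prepends n to the list coded by m, and 0 codes the empty
    list. Pickles of pairs, options and lists are therefore built from [cns] and 0. *)
Definition cns (n m : nat) := 2 ^ n * m.*2.+1.

Definition double_reg :=
  Seq (While 2 (Seq (Do (Dec 2)) (Seq (Do (Inc 1)) (Do (Inc 1))))) (move_reg 1 2).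

Definition cons_regs :=
  Seq (Seq (move_reg 1 2) (Seq double_reg (Do (Inc 2))))
 (Seq (While 0 (Seq (Do (Dec 0)) double_reg)) (move_reg 2 0)).

Lemma calc_double n m :
  calc double_reg (n .: 0 .: m .: zst) (n .: 0 .: m.*2 .: zst).
Proof.
apply: (@calc_seq _ _ _ (n .: m.*2 .: 0 .: zst)); last by apply: calc_move => //; small_reg.
suff H a : calc (While 2 (Seq (Do (Dec 2)) (Seq (Do (Inc 1)) (Do (Inc 1)))))
    (n .: a .: m .: zst) (n .: a + m.*2 .: 0 .: zst) by exact: (H 0).
elim: m a => [|m IH] a; first by rewrite addn0; apply: calc_while0.
apply: (@calc_while1 _ _ _ (n .: a.+2 .: m .: zst)) => //; last first.
  by rewrite doubleS -!addSnnS; apply: IH.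
apply: (@calc_seq _ _ _ (n .: a .: m .: zst)); first by apply: calc_dec; small_reg.
apply: (@calc_seq _ _ _ (n .: a.+1 .: m .: zst)); apply: calc_inc; small_reg.
Qed.

Lemma calc_cons n m : calc cons_regs (n .: m .: zst) (cns n m .: zst).
Proof.
apply: (@calc_seq _ _ _ (n .: 0 .: m.*2.+1 .: zst)).
  apply: (@calc_seq _ _ _ (n .: 0 .: m .: zst)); first by apply: calc_move => //; small_reg.
  by apply: calc_seq (calc_double n m) _; apply: calc_inc; small_reg.
apply: (@calc_seq _ _ _ (0 .: 0 .: cns n m .: zst)); last by apply: calc_move => //; small_reg.
rewrite /cns; elim: n m.*2.+1 => [|n IH] a; first by rewrite mul1n; apply: calc_while0.
apply: (@calc_while1 _ _ _ (n .: 0 .: a.*2 .: zst)) => //; last first.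
  by rewrite expnSr -mulnA mul2n; apply: IH.
by apply: calc_seq (calc_double n a); apply: calc_dec; small_reg.
Qed.

Lemma rc_cns f g : rc f -> rc g -> rc (fun x => cns (f x) (g x)).
Proof.
case=> cf of_ Hf [cg og Hg].
exists (Seq dup (Seq (shift cf) (Seq swap (Seq (shift cg) cons_regs)))).
  by rewrite /= !cmd_one_way_shift of_ og.
move=> x; apply: calc_seq (calc_dup x) _.
apply: calc_seq (calc_shift x (Hf x)) _; apply: calc_seq (calc_swap _ _) _.
by apply: calc_seq (calc_shift _ (Hg x)) (calc_cons _ _).
Qed.

Definition hd (c : nat) : nat := head 0 (CodeSeq.decode c).
Definition tl (c : nat) : nat := CodeSeq.code (behead (CodeSeq.decode c)).

Lemma hd_cns n m : hd (cns n m) = n.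
Proof. by rewrite /hd /cns -[m in LHS]CodeSeq.decodeK (CodeSeq.codeK (n :: _)). Qed.

Lemma tl_cns n m : tl (cns n m) = m.
Proof.
by rewrite /tl /cns -[m in LHS]CodeSeq.decodeK (CodeSeq.codeK (n :: _)) /= CodeSeq.decodeK.
Qed.

Lemma cns_hd_tl c : 0 < c -> cns (hd c) (tl c) = c.
Proof.
rewrite /hd /tl => c0; rewrite -[RHS]CodeSeq.decodeK.
by case: (CodeSeq.decode c) (CodeSeq.decodeK c) c0 => //= <-.
Qed.

Definition half_regs :=
  While 0 (Seq (Do (Dec 0)) (If 0 (Seq (Do (Dec 0)) (Do (Inc 2))) (Do (Inc 3)))).

Lemma calc_half q (b : bool) a r :
  calc half_regs (q.*2 + b .: a .: r .: 0 .: zst) (0 .: a .: r + q .: nat_of_bool b .: zst).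
Proof.
elim: q r => [|q IH] r.
  rewrite addn0; case: b; last by apply: calc_while0.
  apply: (@calc_while1 _ _ _ (0 .: a .: r .: 1 .: zst)) => //; last by apply: calc_while0.
  apply: (@calc_seq _ _ _ (0 .: a .: r .: 0 .: zst)); first by apply: calc_dec; small_reg.
  by apply: calc_if0 => //; apply: calc_inc; small_reg.
apply: (@calc_while1 _ _ _ (q.*2 + b .: a .: r.+1 .: 0 .: zst)) => //; last first.
  by rewrite -addSnnS; apply: IH.
apply: (@calc_seq _ _ _ ((q.*2 + b).+1 .: a .: r .: 0 .: zst)).
  by apply: calc_dec; small_reg.
apply: calc_if1 => //.
apply: (@calc_seq _ _ _ (q.*2 + b .: a .: r .: 0 .: zst)).
  by apply: calc_dec; small_reg.
by apply: calc_inc; small_reg.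
Qed.

(** The exponent is found by repeated halving: an even number yields one more factor 2 and its half
    is moved back to counter 0, while at the odd factor the half is the tail, stays in counter 2 and
    ends the loop. *)
Definition uncons :=
  While 0 (Seq half_regs (If 3 (Do (Dec 3)) (Seq (Do (Inc 1)) (move_reg 2 0)))).

Lemma calc_uncons_cns n m a :
  calc uncons (cns n m .: a .: zst) (0 .: a + n .: m .: zst).
Proof.
elim: n a => [|n IH] a.
  rewrite /cns mul1n addn0.
  apply: (@calc_while1 _ _ _ (0 .: a .: m .: zst)) => //; last by apply: calc_while0.
  apply: (@calc_seq _ _ _ (0 .: a .: m .: 1 .: zst)).
    by move: (@calc_half m true a 0); apply: calc_ext => -[|[|[|[|?]]]] //=; rewrite addn1.
  by apply: calc_if1 => //; apply: calc_dec; small_reg.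
apply: (@calc_while1 _ _ _ (cns n m .: a.+1 .: zst)); last first.
- by rewrite -addSnnS; apply: IH.
- apply: (@calc_seq _ _ _ (0 .: a .: cns n m .: 0 .: zst)).
    move: (@calc_half (cns n m) false a 0); apply: calc_ext => -[|[|[|[|?]]]] //=.
    by rewrite addn0 /cns expnS -mulnA mul2n.
  apply: calc_if0 => //; apply: (@calc_seq _ _ _ (0 .: a.+1 .: cns n m .: 0 .: zst)).
    by apply: calc_inc; small_reg.
  by apply: calc_move => //; small_reg.
by apply/eqP; rewrite /= /cns muln_eq0 expn_eq0.
Qed.

Lemma calc_uncons c : calc uncons (c .: zst) (0 .: hd c .: tl c .: zst).
Proof.
case: c => [|c]; first by apply: calc_while0 => //; small_reg.
rewrite -{1}(@cns_hd_tl c.+1) //.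
by move: (@calc_uncons_cns (hd c.+1) (tl c.+1) 0); apply: calc_ext; small_reg.
Qed.

Lemma rc_hd : rc hd.
Proof.
exists (Seq uncons (Seq (clear 2) (move_reg 1 0))) => // c.
apply: calc_seq (calc_uncons c) _.
apply: (@calc_seq _ _ _ (0 .: hd c .: zst)); first by apply: calc_clear; small_reg.
by apply: calc_move => //; small_reg.
Qed.

Lemma rc_tl : rc tl.
Proof.
exists (Seq uncons (Seq (clear 1) (move_reg 2 0))) => // c.
apply: calc_seq (calc_uncons c) _.
apply: (@calc_seq _ _ _ (0 .: 0 .: tl c .: zst)); first by apply: calc_clear; small_reg.
by apply: calc_move => //; small_reg.
Qed.

Lemma rc_iter f : rc f -> rc (fun x => iter (hd x) f (tl x)).
Proof.
case=> c oc Hc.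
exists (Seq uncons (Seq (move_reg 1 0) (Seq (move_reg 2 1)
  (Seq (While 0 (Seq (Do (Dec 0)) (shift c))) (move_reg 1 0))))).
  by rewrite /= cmd_one_way_shift oc.
move=> x; apply: calc_seq (calc_uncons x) _; move: (hd x) (tl x) => n a.
apply: (@calc_seq _ _ _ (n .: 0 .: a .: zst)); first by apply: calc_move => //; small_reg.
apply: (@calc_seq _ _ _ (n .: a .: zst)); first by apply: calc_move => //; small_reg.
apply: (@calc_seq _ _ _ (0 .: iter n f a .: zst)); last by apply: calc_move => //; small_reg.
elim: n a => [|n IH] a; first by apply: calc_while0.
apply: (@calc_while1 _ _ _ (n .: f a .: zst)) => //; last by rewrite iterSr; apply: IH.
apply: (@calc_seq _ _ _ (n .: a .: zst)); first by apply: calc_dec; small_reg.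
exact: calc_shift.
Qed.

(** * Computable functions between countable types *)

(** Nothing is asked of [g] at numbers that are not codes. *)
Definition cmp (T U : countType) (f : T -> U) : Prop :=
  exists2 g, rc g & forall x, g (pickle x) = pickle (f x).

Lemma rc_ext f g : f =1 g -> rc f -> rc g.
Proof. by move=> fg [c oc Hc]; exists c => // x; rewrite -fg. Qed.

Lemma rc_const n : rc (fun=> n).
Proof. by elim: n => [|n IH]; [exact: rc_const0|exact: (rc_comp rc_succ IH)]. Qed.

Lemma rc_iter_at n f a :
  rc n -> rc f -> rc a -> rc (fun x => iter (n x) f (a x)).
Proof.
move=> rn /rc_iter rf ra; apply: rc_ext (rc_comp rf (rc_cns rn ra)) => x /=.
by rewrite hd_cns tl_cns.
Qed.

(** The case distinction is an iteration of length c(x): starting from the pair (x, g(x)), the step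
    [st] replaces the second component by f(x), so one or more rounds give the same result and no
    round leaves g(x). *)
Lemma rc_if c f g : rc c -> rc f -> rc g -> rc (fun x => if c x == 0 then g x else f x).
Proof.
move=> Hc Hf Hg; pose st a := cns (hd a) (f (hd a)).
have Hst : rc st by apply: rc_cns; [exact: rc_hd|exact: (rc_comp Hf rc_hd)].
apply: rc_ext (rc_comp rc_tl (rc_iter_at Hc Hst (rc_cns rc_id Hg))) => x /=.
case: (c x) => [|n]; first by rewrite tl_cns.
suff /= -> : iter n.+1 st (cns x (g x)) = cns x (f x) by rewrite tl_cns.
by elim: n => [|n IH]; rewrite iterS ?IH /st ?hd_cns.
Qed.

Lemma pickle_pairE (T U : countType) (x : T) (y : U) :
  pickle (x, y) = cns (pickle x) (cns (pickle y) 0).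
Proof. by []. Qed.

Lemma pickle_consE (T : countType) (x : T) s : pickle (x :: s) = cns (pickle x) (pickle s).
Proof. by []. Qed.

Lemma pickle_SomeE (T : countType) (x : T) : pickle (Some x) = cns (pickle x) 0.
Proof. by []. Qed.

Lemma cns_gt0 n m : (cns n m == 0) = false.
Proof. by rewrite /cns muln_eq0 expn_eq0. Qed.

Section Combinators.

Variable X : countType.

Lemma cmp_id : cmp (fun x : X => x).
Proof. by exists id => //; exact: rc_id. Qed.

Lemma cmp_const (T : countType) (t : T) : cmp (fun _ : X => t).
Proof. by exists (fun=> pickle t) => //; exact: rc_const. Qed.

Lemma cmp_comp (T U : countType) (h : T -> U) (f : X -> T) :
  cmp h -> cmp f -> cmp (fun x => h (f x)).
Proof.
case=> h' rh Hh [f' rf Hf]; exists (h' \o f'); first exact: rc_comp.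
by move=> x; rewrite /= Hf Hh.
Qed.

Lemma cmp_ext (T : countType) (f g : X -> T) : f =1 g -> cmp f -> cmp g.
Proof. by move=> fg [c oc Hc]; exists c => // x; rewrite -fg. Qed.

Lemma cmp_pair (T U : countType) (f : X -> T) (g : X -> U) :
  cmp f -> cmp g -> cmp (fun x => (f x, g x)).
Proof.
case=> f' rf Hf [g' rg Hg]; exists (fun n => cns (f' n) (cns (g' n) 0)).
  exact: rc_cns rf (rc_cns rg (rc_const _)).
by move=> x; rewrite Hf Hg.
Qed.

Lemma cmp_fst (T U : countType) (f : X -> T * U) : cmp f -> cmp (fun x => (f x).1).
Proof.
case=> f' rf Hf; exists (hd \o f'); first exact: rc_comp rc_hd rf.
by move=> x /=; rewrite Hf; case: (f x) => a b; rewrite pickle_pairE hd_cns.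
Qed.

Lemma cmp_snd (T U : countType) (f : X -> T * U) : cmp f -> cmp (fun x => (f x).2).
Proof.
case=> f' rf Hf; exists (hd \o (tl \o f')).
  exact: rc_comp rc_hd (rc_comp rc_tl rf).
by move=> x /=; rewrite Hf; case: (f x) => a b; rewrite pickle_pairE tl_cns hd_cns.
Qed.

Lemma cmp_succ (f : X -> nat) : cmp f -> cmp (fun x => (f x).+1).
Proof.
by case=> f' rf Hf; exists (succn \o f'); [exact: rc_comp rc_succ rf|move=> x /=; rewrite Hf].
Qed.

Lemma cmp_pickle (T : countType) (f : X -> T) : cmp f -> cmp (fun x => pickle (f x)).
Proof. by case=> f' rf Hf; exists f'. Qed.

Lemma cmp_decode (f : X -> nat) : cmp f -> cmp (fun x => CodeSeq.decode (f x)).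
Proof.
case=> f' rf Hf; exists f' => // x.
by rewrite Hf -[LHS]CodeSeq.decodeK /pickle /= /pickle_seq map_id.
Qed.

(** The parameter x is carried along in the iterated state, because [rc_iter_at] iterates a function
    without parameters. *)
Lemma cmp_iter (T : countType) (n : X -> nat) (b : X -> T -> T) (z : X -> T) :
  cmp n -> cmp (fun y : X * T => b y.1 y.2) -> cmp z ->
  cmp (fun x => iter (n x) (b x) (z x)).
Proof.
case=> n' rn Hn [b' rb Hb] [z' rz Hz].
pose st s := cns (hd s) (cns (b' s) 0).
have rst : rc st by exact: rc_cns rc_hd (rc_cns rb (rc_const 0)).
have := rc_iter_at rn rst (rc_cns rc_id (rc_cns rz (rc_const 0))).
move=> /(rc_comp rc_tl)/(rc_comp rc_hd) ri; eexists; first exact: ri.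
move=> x /=; rewrite Hn Hz -[pickle (n x)]/(n x).
suff -> k : iter k st (cns (pickle x) (cns (pickle (z x)) 0)) =
          pickle (x, iter k (b x) (z x)) by rewrite pickle_pairE tl_cns hd_cns.
elim: k => //= k ->; rewrite /st Hb /= [in hd _]pickle_pairE hd_cns.
by rewrite pickle_pairE.
Qed.

Lemma cmp_if (T : countType) (b : X -> bool) (f g : X -> T) :
  cmp b -> cmp f -> cmp g -> cmp (fun x => if b x then f x else g x).
Proof.
case=> b' rb Hb [f' rf Hf] [g' rg Hg].
exists (fun n => if b' n == 0 then g' n else f' n); first exact: rc_if.
by move=> x; rewrite Hb Hf Hg; case: (b x).
Qed.

Lemma cmp_Some (T : countType) (f : X -> T) : cmp f -> cmp (fun x => Some (f x)).
Proof.
case=> f' rf Hf; exists (fun n => cns (f' n) 0); first exact: rc_cns rf (rc_const 0).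
by move=> x; rewrite Hf.
Qed.

Lemma cmp_case_option (T U : countType) (o : X -> option T) (f : X -> T -> U) g :
  cmp o -> cmp (fun y : X * T => f y.1 y.2) -> cmp g ->
  cmp (fun x => if o x is Some t then f x t else g x).
Proof.
case=> o' ro Ho [f' rf Hf] [g' rg Hg].
exists (fun n => if o' n == 0 then g' n else f' (cns n (cns (hd (o' n)) 0))).
  apply: (rc_if ro _ rg); apply: (rc_comp rf).
  exact: rc_cns rc_id (rc_cns (rc_comp rc_hd ro) (rc_const 0)).
move=> x; rewrite Ho; case: (o x) => [t|]; last by rewrite Hg.
by rewrite pickle_SomeE cns_gt0 hd_cns -pickle_pairE Hf.
Qed.

Lemma cmp_cons (T : countType) (f : X -> T) s :
  cmp f -> cmp s -> cmp (fun x => f x :: s x).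
Proof.
case=> f' rf Hf [s' rs Hs]; exists (fun n => cns (f' n) (s' n)); first exact: rc_cns.
by move=> x; rewrite Hf Hs.
Qed.

Lemma cmp_case_seq (T U : countType) (s : X -> seq T) (f : X -> T -> seq T -> U) g :
  cmp s -> cmp (fun y : X * (T * seq T) => f y.1 y.2.1 y.2.2) -> cmp g ->
  cmp (fun x => if s x is a :: l then f x a l else g x).
Proof.
case=> s' rs Hs [f' rf Hf] [g' rg Hg].
exists (fun n => if s' n == 0 then g' n
  else f' (cns n (cns (cns (hd (s' n)) (cns (tl (s' n)) 0)) 0))).
  apply: (rc_if rs _ rg); apply: (rc_comp rf).
  apply: (rc_cns rc_id (rc_cns _ (rc_const 0))).
  exact: rc_cns (rc_comp rc_hd rs) (rc_cns (rc_comp rc_tl rs) (rc_const 0)).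
move=> x; rewrite Hs; case: (s x) => [|a l]; first by rewrite Hg.
by rewrite pickle_consE cns_gt0 hd_cns tl_cns -pickle_pairE -pickle_pairE Hf.
Qed.

End Combinators.

(** It makes the pickle of a list a computable bound on the number of iterations needed to traverse
    the list. *)
Lemma size_pickle (T : countType) (s : seq T) : size s <= pickle s.
Proof.
elim: s => // x s IH; rewrite pickle_consE /= /cns.
apply: leq_trans (leq_pmull _ _); last by rewrite expn_gt0.
by rewrite ltnS -addnn (leq_trans IH) ?leq_addr.
Qed.

Lemma cmp_foldl (X A B : countType) (b : X -> A -> B -> A) (z : X -> A) (s : X -> seq B) :
  cmp (fun y : X * (A * B) => b y.1 y.2.1 y.2.2) -> cmp z -> cmp s ->
  cmp (fun x => foldl (b x) (z x) (s x)).
Proof.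
move=> Hb Hz Hs.
pose st x (c : A * seq B) := if c.2 is y :: l then (b x c.1 y, l) else c.
apply: (@cmp_ext _ _ (fun x => (iter (pickle (s x)) (st x) (z x, s x)).1)).
  move=> x; have := size_pickle (s x); move: (pickle (s x)) (z x) => n.
  elim: n (s x) => [|n IH] [|y l] a //=; last first.
    by move=> ln; rewrite -iterS iterSr /st /= -/(st x) IH.
  by move=> _; rewrite -/(iter n.+1 (st x) _) iterSr IH.
apply: cmp_fst; apply: cmp_iter; [exact: cmp_pickle| |exact: cmp_pair].
apply: cmp_case_seq; first exact: cmp_snd (cmp_snd (cmp_id _)).
  apply: cmp_pair; last exact: cmp_snd (cmp_snd (cmp_id _)).
  pose h (y : X * (A * seq B) * (B * seq B)) := (y.1.1, (y.1.2.1, y.2.1)).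
  apply: (@cmp_comp _ _ _ _ h Hb).
  apply: cmp_pair; first exact: cmp_fst (cmp_fst (cmp_id _)).
  apply: cmp_pair; first exact: cmp_fst (cmp_snd (cmp_fst (cmp_id _))).
  exact: cmp_fst (cmp_snd (cmp_id _)).
exact: cmp_snd (cmp_id _).
Qed.

(** These hooks are redefined below whenever a further group of closure lemmas is available. *)
Ltac cmp_head1 := fail.
Ltac cmp_head2 := fail.
Ltac cmp_head3 := fail.

(* Without the inspection of the head symbol, [cmp_if] would apply to any
   boolean expression. *)
Ltac cmp_match :=
  lazymatch goal with
  | |- @cmp ?X _ ?f =>
    let k := constr:(fun x : X => ltac:(
      let t := eval cbv beta in (f x) in
      lazymatch t with
      | if _ then _ else _ => exact 0
      | match _ with Some _ => _ | None => _ end => exact 1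
      | match _ with nil => _ | cons _ _ => _ end => exact 2
      end)) in
    lazymatch k with
    | fun _ => 0 => apply: cmp_if
    | fun _ => 1 => apply: cmp_case_option
    | fun _ => 2 => apply: cmp_case_seq
    end
  end.

Ltac cmp_step :=
  cbn beta;
  lazymatch goal with
  | |- cmp (fun _ => ?t) => exact: cmp_const
  | |- cmp (fun x => x) => exact: cmp_id
  | |- cmp fst => exact: (cmp_fst (cmp_id _))
  | |- cmp snd => exact: (cmp_snd (cmp_id _))
  | |- cmp CodeSeq.decode => exact: (cmp_decode (cmp_id _))
  | |- _ => first [ assumption | lazymatch goal with
    | |- cmp (fun x => (@?f x, @?g x)) => apply: cmp_pair
    | |- cmp (fun x => fst (@?f x)) => apply: cmp_fst
    | |- cmp (fun x => snd (@?f x)) => apply: cmp_snd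
    | |- cmp (fun x => S (@?f x)) => apply: cmp_succ
    | |- cmp (fun x => cons (@?f x) (@?g x)) => apply: cmp_cons
    | |- cmp (fun x => Some (@?f x)) => apply: cmp_Some
    | |- cmp (fun x => pickle (@?f x)) => apply: cmp_pickle
    | |- cmp (fun x => CodeSeq.decode (@?f x)) => apply: cmp_decode
    | |- cmp (fun x => foldl (@?b x) (@?z x) (@?s x)) => apply: cmp_foldl
    | |- cmp (fun x => iter (@?n x) (@?b x) (@?z x)) => apply: cmp_iter
    | |- _ => first [ cmp_head1 | cmp_head2 | cmp_head3 | cmp_match ]
    end ]
  end.

Ltac cmp_tac := repeat cmp_step.

Lemma cmp_app2 (X A B C : countType) (h : A -> B -> C) (f : X -> A) (g : X -> B) :
  cmp (fun y => h y.1 y.2) -> cmp f -> cmp g -> cmp (fun x => h (f x) (g x)).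
Proof. by move=> Hh Hf Hg; apply: (cmp_comp Hh (cmp_pair Hf Hg)). Qed.

Lemma cmp_app3 (X A B C D : countType) (h : A -> B -> C -> D)
    (f : X -> A) (g : X -> B) (k : X -> C) :
  cmp (fun y => h y.1 y.2.1 y.2.2) -> cmp f -> cmp g -> cmp k ->
  cmp (fun x => h (f x) (g x) (k x)).
Proof. by move=> Hh Hf Hg Hk; apply: (cmp_comp Hh (cmp_pair Hf (cmp_pair Hg Hk))). Qed.

Lemma cmp_pred (X : countType) (f : X -> nat) : cmp f -> cmp (fun x => (f x).-1).
Proof.
(* Kleene's predecessor: the pair keeps the previous counter value next to the current one. *)
move=> Hf; pose st (a : nat * nat) := (a.2, a.2.+1).
apply: (@cmp_ext _ _ (fun x => (iter (f x) st (0, 0)).1)).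
  move=> x; have : forall n, iter n st (0, 0) = (n.-1, n) by elim=> //= n ->.
  by move=> ->.
rewrite /st; cmp_tac.
Qed.

Lemma cmp_add (X : countType) (f g : X -> nat) : cmp f -> cmp g -> cmp (fun x => f x + g x).
Proof.
move=> Hf Hg; apply: (@cmp_ext _ _ (fun x => iter (f x) (fun n => n.+1) (g x))).
  by move=> x; rewrite iter_succn addnC.
by cmp_tac.
Qed.

Lemma cmp_sub (X : countType) (f g : X -> nat) : cmp f -> cmp g -> cmp (fun x => f x - g x).
Proof.
move=> Hf Hg; apply: (@cmp_ext _ _ (fun x => iter (g x) (fun n => n.-1) (f x))).
  by move=> x; rewrite iter_predn.
by apply: cmp_iter => //; apply: cmp_comp (cmp_snd (cmp_id _)); apply: cmp_pred; exact: cmp_id.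
Qed.

Lemma cmp_eq0 (X : countType) (f : X -> nat) : cmp f -> cmp (fun x => f x == 0).
Proof.
case=> f' rf Hf; exists (fun n => if f' n == 0 then 1 else 0).
  exact: rc_if rf (rc_const 0) (rc_const 1).
by move=> x; rewrite Hf -[pickle (f x)]/(f x); case: (f x).
Qed.

Lemma cmp_leq (X : countType) (f g : X -> nat) : cmp f -> cmp g -> cmp (fun x => f x <= g x).
Proof. by move=> Hf Hg; apply: cmp_eq0; apply: cmp_sub. Qed.

Lemma cmp_and (X : countType) (f g : X -> bool) : cmp f -> cmp g -> cmp (fun x => f x && g x).
Proof. by move=> Hf Hg; apply: cmp_if => //; apply: cmp_const. Qed.

Lemma cmp_neg (X : countType) (f : X -> bool) : cmp f -> cmp (fun x => ~~ f x).
Proof. by move=> Hf; apply: cmp_if => //; apply: cmp_const. Qed.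

Lemma cmp_eq (X T : countType) (f g : X -> T) : cmp f -> cmp g -> cmp (fun x => f x == g x).
Proof.
move=> Hf Hg.
apply: (@cmp_ext _ _ (fun x => (pickle (f x) <= pickle (g x)) && (pickle (g x) <= pickle (f x)))).
  by move=> x; rewrite -eqn_leq (inj_eq (pcan_inj pickleK)).
by apply: cmp_and; apply: cmp_leq; apply: cmp_pickle.
Qed.

Lemma cmp_odd (X : countType) (f : X -> nat) : cmp f -> cmp (fun x => odd (f x)).
Proof.
move=> Hf; apply: (@cmp_ext _ _ (fun x => iter (f x) negb false)).
  by move=> x; elim: (f x) => //= n ->.
by apply: cmp_iter => //; [apply: cmp_neg; exact: cmp_snd (cmp_id _)|exact: cmp_const].
Qed.

Lemma cmp_half (X : countType) (f : X -> nat) : cmp f -> cmp (fun x => (f x)./2).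
Proof.
move=> Hf; pose st (a : nat * nat) := (a.2, a.1.+1).
apply: (@cmp_ext _ _ (fun x => (iter (f x) st (0, 0)).1)).
  move=> x; have : forall n, iter n st (0, 0) = (n./2, uphalf n) by elim=> //= n ->.
  by move=> ->.
by rewrite /st; cmp_tac.
Qed.

Ltac cmp_head1 ::=
  lazymatch goal with
  | |- cmp (fun x => predn (@?f x)) => apply: cmp_pred
  | |- cmp (fun x => addn (@?f x) (@?g x)) => apply: cmp_add
  | |- cmp (fun x => subn (@?f x) (@?g x)) => apply: cmp_sub
  | |- cmp (fun x => leq (@?f x) (@?g x)) => apply: cmp_leq
  | |- cmp (fun x => andb (@?f x) (@?g x)) => apply: cmp_and
  | |- cmp (fun x => negb (@?f x)) => apply: cmp_neg
  | |- cmp (fun x => odd (@?f x)) => apply: cmp_odd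
  | |- cmp (fun x => half (@?f x)) => apply: cmp_half
  | |- cmp (fun x => eq_op (@?f x) (@?g x)) => apply: cmp_eq
  end.

Lemma cmp_rev (X T : countType) (s : X -> seq T) : cmp s -> cmp (fun x => rev (s x)).
Proof.
move=> Hs; apply: (@cmp_ext _ _ (fun x => foldl (fun l a => a :: l) [::] (s x))).
  by move=> x; rewrite /rev; elim: (s x) [::] => //= a l IH l'; rewrite IH.
by cmp_tac.
Qed.

Lemma cmp_foldr (X A B : countType) (b : X -> A -> B -> B) (z : X -> B) (s : X -> seq A) :
  cmp (fun y : X * (A * B) => b y.1 y.2.1 y.2.2) -> cmp z -> cmp s ->
  cmp (fun x => foldr (b x) (z x) (s x)).
Proof.
move=> Hb Hz Hs.
apply: (@cmp_ext _ _ (fun x => foldl (fun c a => b x a c) (z x) (rev (s x)))).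
  by move=> x; rewrite foldl_rev.
by apply: cmp_foldl => //; [apply: (cmp_app3 Hb); cmp_tac|apply: cmp_rev].
Qed.

Lemma cmp_map (X T U : countType) (h : X -> T -> U) (s : X -> seq T) :
  cmp (fun y : X * T => h y.1 y.2) -> cmp s -> cmp (fun x => map (h x) (s x)).
Proof.
move=> Hh Hs.
apply: (@cmp_ext _ _ (fun x => foldr (fun a l => h x a :: l) [::] (s x))); first by [].
by apply: cmp_foldr; cmp_tac; apply: (cmp_app2 Hh); cmp_tac.
Qed.

Lemma cmp_filter (X T : countType) (h : X -> T -> bool) (s : X -> seq T) :
  cmp (fun y : X * T => h y.1 y.2) -> cmp s -> cmp (fun x => filter (h x) (s x)).
Proof.
move=> Hh Hs.
apply: (@cmp_ext _ _ (fun x => foldr (fun a l => if h x a then a :: l else l) [::] (s x))).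
  by move=> x; elim: (s x) => //= a l ->.
by apply: cmp_foldr; cmp_tac; apply: (cmp_app2 Hh); cmp_tac.
Qed.

Lemma cmp_pmap (X T U : countType) (h : X -> T -> option U) (s : X -> seq T) :
  cmp (fun y : X * T => h y.1 y.2) -> cmp s -> cmp (fun x => pmap (h x) (s x)).
Proof.
move=> Hh Hs.
apply: (@cmp_ext _ _ (fun x => foldr (fun a l => if h x a is Some b then b :: l else l)
                                     [::] (s x))).
  by move=> x; elim: (s x) => //= a l ->; case: h.
by apply: cmp_foldr; cmp_tac; apply: (cmp_app2 Hh); cmp_tac.
Qed.

Lemma cmp_all (X T : countType) (h : X -> T -> bool) (s : X -> seq T) :
  cmp (fun y : X * T => h y.1 y.2) -> cmp s -> cmp (fun x => all (h x) (s x)).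
Proof.
move=> Hh Hs.
apply: (@cmp_ext _ _ (fun x => foldr (fun a b => h x a && b) true (s x))); first by [].
by apply: cmp_foldr; cmp_tac; apply: (cmp_app2 Hh); cmp_tac.
Qed.

Lemma cmp_cat (X T : countType) (s t : X -> seq T) :
  cmp s -> cmp t -> cmp (fun x => s x ++ t x).
Proof.
move=> Hs Ht; apply: (@cmp_ext _ _ (fun x => foldr cons (t x) (s x))).
  by move=> x; elim: (s x) => //= a l ->.
by apply: cmp_foldr; cmp_tac.
Qed.

Lemma cmp_flatten (X T : countType) (s : X -> seq (seq T)) :
  cmp s -> cmp (fun x => flatten (s x)).
Proof. by move=> Hs; apply: cmp_foldr; cmp_tac; apply: cmp_cat; cmp_tac. Qed.

Lemma cmp_size (X T : countType) (s : X -> seq T) : cmp s -> cmp (fun x => size (s x)).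
Proof.
move=> Hs; apply: (@cmp_ext _ _ (fun x => foldr (fun _ n => n.+1) 0 (s x))); first by [].
by cmp_tac; apply: cmp_foldr; cmp_tac.
Qed.

Lemma cmp_nth (X T : countType) (x0 : T) (s : X -> seq T) n :
  cmp s -> cmp n -> cmp (fun x => nth x0 (s x) (n x)).
Proof.
move=> Hs Hn.
apply: (@cmp_ext _ _ (fun x => if iter (n x) behead (s x) is a :: l then a else x0)).
  by move=> x; elim: (n x) (s x) => [|k IH] [|a l] //; rewrite iterSr IH ?nth_nil.
cmp_tac.
apply: (@cmp_ext _ _ (fun y : X * seq T => if y.2 is a :: l then l else [::])).
  by case=> ? [].
by cmp_tac.
Qed.

Lemma cmp_mkseq (X T : countType) (h : X -> nat -> T) (n : X -> nat) :
  cmp (fun y : X * nat => h y.1 y.2) -> cmp n -> cmp (fun x => mkseq (h x) (n x)).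
Proof.
move=> Hh Hn; apply: cmp_map => //.
pose st (c : nat * seq nat) := (c.1.-1, c.1.-1 :: c.2).
apply: (@cmp_ext _ _ (fun x => (iter (n x) st (n x, [::])).2)).
  move=> x; suff -> : forall k, k <= n x -> iter k st (n x, [::]) = (n x - k, iota (n x - k) k).
  - by rewrite subnn.
  - by [].
  elim=> [|k IH] kn; first by rewrite subn0.
  rewrite iterS IH ?(ltnW kn) // /st /= subnS; congr pair; congr cons.
  by rewrite prednK // subn_gt0.
by rewrite /st; cmp_tac.
Qed.

Ltac cmp_head2 ::=
  lazymatch goal with
  | |- cmp (fun x => rev (@?s x)) => apply: cmp_rev
  | |- cmp (fun x => foldr (@?b x) (@?z x) (@?s x)) => apply: cmp_foldr
  | |- cmp (fun x => map (@?b x) (@?s x)) => apply: cmp_map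
  | |- cmp (fun x => filter (@?b x) (@?s x)) => apply: cmp_filter
  | |- cmp (fun x => pmap (@?b x) (@?s x)) => apply: cmp_pmap
  | |- cmp (fun x => all (@?b x) (@?s x)) => apply: cmp_all
  | |- cmp (fun x => cat (@?s x) (@?t x)) => apply: cmp_cat
  | |- cmp (fun x => flatten (@?s x)) => apply: cmp_flatten
  | |- cmp (fun x => size (@?s x)) => apply: cmp_size
  | |- cmp (fun x => nth _ (@?s x) (@?n x)) => apply: cmp_nth
  | |- cmp (fun x => mkseq (@?h x) (@?n x)) => apply: cmp_mkseq
  end.

(** * Simulation of Turing machines *)

(** The number of tapes is forgotten in the type, so that rules of all machines live in one
    countable type on which [cmp] can speak of them. *)
Definition raw_rule : Type :=
  nat * nat * seq nat * nat * (nat * direction * seq action * action).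

Definition raw_of_rule k (r : rule k) : raw_rule :=
  (src_state r, read_input r, tval (read_work r), read_output r,
   (dst_state r, move_input r, tval (act_work r), act_output r)).

Definition raw_machine : Type := nat * seq raw_rule.

Definition raw_of_machine (M : machine) : raw_machine :=
  (work_tapes M, map (@raw_of_rule _) (rules M)).

Definition fits k (r : raw_rule) : bool :=
  (size r.1.1.2 == k) && (size r.2.1.2 == k).

(** This retraces [unpickle] at the type of machines: a list of two numbers, the second one coding
    the rules. Decoding a list drops the entries that are not codes, and for rules with k tapes this
    includes those of the wrong length, hence the filter. *)
Definition nth_raw (i : nat) : raw_machine :=
  if CodeSeq.decode i is k :: l then
    if l is x :: l' then
      if l' is _ :: _ then (0, [::])
      else (k, [seq r <- pmap unpickle (CodeSeq.decode x) | fits k r])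
    else (0, [::])
  else (0, [::]).

Definition guard T (P : pred T) (x : T) : option T := if P x then Some x else None.

Lemma unpickle_pair (T U : countType) n :
  unpickle n = if CodeSeq.decode n is a :: l then
    if l is b :: l' then
      if l' is _ :: _ then None
      else if unpickle a is Some x then
        if unpickle b is Some y then Some (x, y) else None
      else None
    else None
  else None :> option (T * U).
Proof.
rewrite {1}/unpickle /= /pcomp /= {1}/unpickle /= /unpickle_tagged.
case: (CodeSeq.decode n) => [|a [|b [|c l]]] //=.
by case: (unpickle a) => //= x; case: (unpickle b).
Qed.

(** [T'] embeds into [T] as the part satisfying [P], with unchanged codes, so that decoding at [T']
    is decoding at [T] followed by a test. *)
Definition codes_sub (T' T : countType) (f : T' -> T) (P : pred T) : Prop :=
  forall n, omap f (unpickle n) = obind (guard P) (unpickle n).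

Lemma codes_sub_id (T : countType) : codes_sub (@id T) predT.
Proof. by move=> n; case: (unpickle n). Qed.

Lemma codes_sub_tuple k (T : countType) :
  codes_sub (fun t : k.-tuple T => tval t) (fun s => size s == k).
Proof.
move=> n; rewrite [X in omap _ X]/unpickle /= /pcomp /=.
move: (pmap _ _) => s; rewrite /guard; case: ifP => Hs.
  by rewrite insubT.
by rewrite insubF.
Qed.

Lemma codes_sub_pair (T' T U' U : countType) (f : T' -> T) P (g : U' -> U) Q :
  codes_sub f P -> codes_sub g Q ->
  codes_sub (fun x => (f x.1, g x.2)) (fun x => P x.1 && Q x.2).
Proof.
move=> Hf Hg n; rewrite !unpickle_pair.
case: (CodeSeq.decode n) => [|a [|b [|c l]]] //=.
move: (Hf a) (Hg b); case: (unpickle a) (unpickle a) => [x|] [y|] //=;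
  case: (unpickle b) (unpickle b) => [z|] [w|] //=; rewrite /guard /=;
  (try case: (P x)); (try case: (Q z)) => //= *; congruence.
Qed.

Lemma codes_sub_rule k : codes_sub (@raw_of_rule k) (fits k).
Proof.
pose T' : countType := (nat * nat * k.-tuple nat * nat *
         (nat * direction * k.-tuple action * action))%type.
have H : codes_sub (fun x : T' => raw_of_rule (rule_decode x)) (fits k).
  have := codes_sub_pair (codes_sub_pair (codes_sub_pair (@codes_sub_id (nat * nat)%type)
    (@codes_sub_tuple k nat)) (@codes_sub_id nat))
    (codes_sub_pair (codes_sub_pair (@codes_sub_id (nat * direction)%type)
    (@codes_sub_tuple k action)) (@codes_sub_id action)).
  move=> H n; rewrite (_ : omap _ _ = omap (fun x : T' => ((x.1.1.1, tval x.1.1.2, x.1.2),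
    ((x.2.1.1, tval x.2.1.2), x.2.2)) : raw_rule) (unpickle n)); last first.
    by case: (unpickle n) => //= -[[[[? ?] ?] ?] [[[? ?] ?] ?]].
  rewrite H; case: (unpickle n) => //= r; rewrite /guard /fits /=.
  by rewrite !andbT.
move=> n; rewrite -H [X in omap _ X = _]/unpickle /= /pcomp.
by case: (unpickle n).
Qed.

Lemma nth_rawE i : nth_raw i = raw_of_machine (nth_machine i).
Proof.
rewrite /nth_machine {1}/unpickle /= /pcomp /= {1}/unpickle /= /unpickle_tagged /nth_raw.
case: (CodeSeq.decode i) => [|k [|x [|? ?]]] //=.
rewrite /raw_of_machine /=; congr pair.
elim: (CodeSeq.decode x) => //= c l.
have := @codes_sub_rule k c.
case: (unpickle c) (unpickle c) => [r|] [r'|] //=; rewrite /guard.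
  by case: ifP => // _ [<-] /= ->.
by case: ifP.
Qed.

Definition cmp_unp (T : countType) : Prop := cmp (fun n : nat => unpickle n : option T).

Lemma cmp_unp_nat : cmp_unp nat.
Proof. by apply: (@cmp_ext _ _ (fun n : nat => Some n)); last cmp_tac. Qed.

Lemma cmp_unp_direction : cmp_unp direction.
Proof.
apply: (@cmp_ext _ _ (fun n : nat => Some (if CodeSeq.decode n is a :: _ then
  if odd a then Right else Left else Stay))).
  move=> n; rewrite [RHS]/unpickle /= /pcomp /=.
  case: (CodeSeq.decode n) => //= a l; congr Some.
by cmp_tac.
Qed.

Lemma cmp_unp_pair (T U : countType) : cmp_unp T -> cmp_unp U -> cmp_unp (T * U)%type.
Proof.
move=> HT HU; apply: (@cmp_ext _ _ _ _ (fun n => esym (@unpickle_pair T U n))).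
cmp_tac.
  by apply: (cmp_comp HT); cmp_tac.
by apply: (cmp_comp HU); cmp_tac.
Qed.

Lemma cmp_unp_seq (T : countType) : cmp_unp T -> cmp_unp (seq T).
Proof.
move=> HT; apply: (@cmp_ext _ _ (fun n : nat => Some (pmap (@unpickle T) (CodeSeq.decode n)))).
  by [].
by cmp_tac; apply: (cmp_comp HT); cmp_tac.
Qed.

Lemma cmp_nth_raw (X : countType) (f : X -> nat) : cmp f -> cmp (fun x => nth_raw (f x)).
Proof.
apply: cmp_comp; rewrite /nth_raw /fits.
have Ha : cmp_unp action by apply: cmp_unp_pair; [exact: cmp_unp_nat|exact: cmp_unp_direction].
have H : cmp_unp raw_rule.
  do ?apply: cmp_unp_pair => //; try exact: cmp_unp_nat; try exact: cmp_unp_direction.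
    by apply: cmp_unp_seq; exact: cmp_unp_nat.
  exact: cmp_unp_seq.
by cmp_tac; apply: (cmp_comp H); cmp_tac.
Qed.

Lemma cmp_rcons (X T : countType) (s : X -> seq T) f :
  cmp s -> cmp f -> cmp (fun x => rcons (s x) (f x)).
Proof.
move=> Hs Hf; apply: (@cmp_ext _ _ (fun x => s x ++ [:: f x])); last by cmp_tac.
by move=> x; rewrite cats1.
Qed.

Lemma cmp_nseq (X T : countType) n (f : X -> T) :
  cmp n -> cmp f -> cmp (fun x => nseq (n x) (f x)).
Proof.
move=> Hs Hf; apply: (@cmp_ext _ _ (fun x => iter (n x) (cons (f x)) [::])) => //.
by cmp_tac; apply: (cmp_comp Hf); cmp_tac.
Qed.

Lemma cmp_move_head (X : countType) d (h : X -> nat) :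
  cmp d -> cmp h -> cmp (fun x => move_head (d x) (h x)).
Proof.
move=> Hd Hh; apply: (@cmp_ext _ _ (fun x =>
  if d x == Left then (h x).-1 else if d x == Right then (h x).+1 else h x)).
  by move=> x; case: (d x).
by cmp_tac.
Qed.

Lemma cmp_write_numbers (X : countType) (s : X -> seq nat) :
  cmp s -> cmp (fun x => write_numbers (s x)).
Proof.
move=> Hs; rewrite /write_numbers; cmp_tac; apply: cmp_rcons; last cmp_tac.
by apply: cmp_nseq; cmp_tac.
Qed.

Ltac cmp_head3 ::=
  lazymatch goal with
  | |- cmp (fun x => rcons (@?s x) (@?n x)) => apply: cmp_rcons
  | |- cmp (fun x => nseq (@?s x) (@?n x)) => apply: cmp_nseq
  | |- cmp (fun x => move_head (@?s x) (@?n x)) => apply: cmp_move_head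
  | |- cmp (fun x => write_numbers (@?s x)) => apply: cmp_write_numbers
  | |- cmp (fun x => nth_raw (@?s x)) => apply: cmp_nth_raw
  end.

Definition raw_tape : Type := nat * seq nat.

Definition raw_config : Type := nat * nat * seq raw_tape * raw_tape.

Definition raw_scanned (t : raw_tape) : nat := nth blank t.2 t.1.

(** The list is lengthened so as to contain the scanned cell; cells beyond it count as blank. *)
Definition raw_act (a : action) (t : raw_tape) : raw_tape :=
  (move_head a.2 t.1,
   mkseq (fun i => if i == t.1 then a.1 else nth blank t.2 i) (t.1.+1 + size t.2)).

(* The list [l] stands for the infinite input [nth 0 l]. *)
Definition raw_applies (l : seq nat) (c : raw_config) (r : raw_rule) : bool :=
  [&& r.1.1.1.1 == c.1.1.1,
      r.1.1.1.2 == nth blank (write_numbers (mkseq (nth 0 l) c.1.1.2.+1)) c.1.1.2,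
      r.1.1.2 == map raw_scanned c.1.2 &
      r.1.2 == raw_scanned c.2].

Definition raw_apply (r : raw_rule) (c : raw_config) : raw_config :=
  (r.2.1.1.1, move_head r.2.1.1.2 c.1.1.2,
   mkseq (fun j => raw_act (nth (0, Stay) r.2.1.2 j) (nth (0, [::]) c.1.2 j)) (size c.1.2),
   raw_act r.2.2 c.2).

Definition raw_step (rs : seq raw_rule) (l : seq nat) (c : raw_config) : raw_config :=
  if [seq r <- rs | raw_applies l c r] is r :: _ then raw_apply r c else c.

Definition raw_run (m : raw_machine) (l : seq nat) (t : nat) : raw_config :=
  iter t (raw_step m.2 l) (0, 0, nseq m.1 (0, [::]), (0, [::])).

Definition raw_halted (m : raw_machine) (l : seq nat) (t : nat) : bool :=
  if [seq r <- m.2 | raw_applies l (raw_run m l t) r] is _ :: _ then false else true.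

Lemma cmp_raw_run (X : countType) m l (t : X -> nat) :
  cmp m -> cmp l -> cmp t -> cmp (fun x => raw_run (m x) (l x) (t x)).
Proof.
apply: cmp_app3.
rewrite /raw_run /raw_step /raw_apply /raw_applies /raw_act /raw_scanned.
by cmp_tac.
Qed.

Lemma cmp_raw_halted (X : countType) m l (t : X -> nat) :
  cmp m -> cmp l -> cmp t -> cmp (fun x => raw_halted (m x) (l x) (t x)).
Proof.
apply: cmp_app3; rewrite /raw_halted /raw_applies /raw_scanned.
pose h (y : raw_machine * (seq nat * nat)) := raw_run y.1 y.2.1 y.2.2.
have Hh : cmp h by apply: cmp_raw_run; cmp_tac.
have Hh' (T : countType) (f : T -> raw_machine) g k : cmp f -> cmp g -> cmp k ->
  cmp (fun x => raw_run (f x) (g x) (k x)) by exact: cmp_raw_run.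
by do 20?[cmp_step | apply: Hh'].
Qed.

Definition tape_ok (rt : raw_tape) (t : tape) : Prop :=
  Defs.head t = rt.1 /\ cells t = nth blank rt.2.

Definition config_ok k (rc : raw_config) (c : config k) : Prop :=
  [/\ state c = rc.1.1.1, input_head c = rc.1.1.2, size rc.1.2 = k,
      forall j : 'I_k, tape_ok (nth (0, [::]) rc.1.2 j) (tnth (work c) j) &
      tape_ok rc.2 (output c)].

Lemma scanned_ok rt t : tape_ok rt t -> scanned t = raw_scanned rt.
Proof. by case=> h c; rewrite /scanned h c. Qed.

Lemma act_ok a rt t : tape_ok rt t -> tape_ok (raw_act a rt) (act a t).
Proof.
case: rt => h s [/= h_ c_]; split; rewrite /= ?h_ ?c_ //.
apply/funext => i; case: (ltnP i (h.+1 + size s)) => Hi.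
  by rewrite nth_mkseq.
rewrite [RHS]nth_default ?size_mkseq // gtn_eqF ?nth_default //; lia.
Qed.

Lemma applies_ok k l rc (c : config k) r : config_ok rc c ->
  applies (nth 0 l) c r = raw_applies l rc (raw_of_rule r).
Proof.
case=> sc ic wc Hw Ho; rewrite /applies /raw_applies /= sc ic (scanned_ok Ho).
do 2!congr andb; congr andb; rewrite -val_eqE /=; congr eq_op.
apply: (@eq_from_nth _ 0); rewrite ?size_map ?size_tuple // => j jk.
rewrite (nth_map blank_tape) ?size_tuple // (nth_map (0, [::])) ?wc //.
by rewrite -(scanned_ok (Hw (Ordinal jk))) (tnth_nth blank_tape).
Qed.

Lemma current_rule_ok M l rc (c : config (work_tapes M)) : config_ok rc c ->
  omap (@raw_of_rule _) (current_rule (nth 0 l) c) =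
  ohead [seq r <- (raw_of_machine M).2 | raw_applies l rc r].
Proof.
move=> H; rewrite /current_rule /=; elim: (rules M) => //= r rs IH.
by rewrite (applies_ok _ _ H); case: ifP.
Qed.

Lemma step_ok M l rc (c : config (work_tapes M)) : config_ok rc c ->
  config_ok (raw_step (raw_of_machine M).2 l rc) (step (nth 0 l) c).
Proof.
move=> H; have := current_rule_ok l H; rewrite /step /raw_step.
case: (current_rule _ _) => [r|]; case: filter => [|r' rs] //= -[<-].
case: H => sc ic wc Hw Ho; split=> //=; rewrite ?ic ?size_mkseq //.
  move=> j; rewrite (tnth_act (act_work r) (work c)) nth_mkseq ?wc //.
  by rewrite -(tnth_nth (0, Stay)); apply: act_ok.
exact: act_ok.
Qed.

Lemma run_ok M l t : config_ok (raw_run (raw_of_machine M) l t) (run M (nth 0 l) t).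
Proof.
elim: t => [|t IH]; last by rewrite /raw_run /run !iterS; apply: step_ok.
split=> //=; first by rewrite size_nseq.
move=> j; rewrite tnth_nseq nth_nseq ltn_ord; split=> //=.
by apply/funext => i; rewrite nth_nil.
by split=> //=; apply/funext => i; rewrite nth_nil.
Qed.

Lemma raw_haltedP M l t :
  raw_halted (raw_of_machine M) l t <-> current_rule (nth 0 l) (run M (nth 0 l) t) = None.
Proof.
have := current_rule_ok l (run_ok M l t); rewrite /raw_halted.
by case: (current_rule _ _) => [r|]; case: filter.
Qed.

(* The input head moves by at most one cell per step, and the content of cell i
   is determined by the first i.+1 values of the input. *)
Lemma run_prefix M p q t : (forall i, i < t -> p i = q i) -> run M p t = run M q t.
Proof.
have Hh t' : input_head (run M p t') <= t'.
  elim: t' => // t' IH; rewrite /run iterS -/(run M p t') /step.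
  case: (current_rule _ _) => [r|] /=; last exact: leqW.
  by case: (move_input r) => /=; lia.
elim: t => // t IH pq; rewrite /run !iterS -/(run M p t) -/(run M q t) -IH; last first.
  by move=> i it; apply: pq; lia.
suff E : input_tape p (input_head (run M p t)) = input_tape q (input_head (run M p t)).
  by rewrite /step /current_rule /applies E.
rewrite /input_tape; congr (nth _ (write_numbers _) _).
apply/eq_in_map => i; rewrite mem_iota => /= Hi; apply: pq.
by have := Hh t; lia.
Qed.

(** * Machines with input and output *)

Lemma write_numbers_rcons s m :
  write_numbers (rcons s m) = write_numbers s ++ rcons (nseq m stroke) separator.
Proof. by rewrite /write_numbers map_rcons flatten_rcons. Qed.

Lemma leq_size_write_numbers s : size s <= size (write_numbers s).
Proof.
elim/last_ind: s => // s m IH; rewrite write_numbers_rcons size_cat !size_rcons.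
by rewrite addnS ltnS (leq_trans IH) ?leq_addr.
Qed.

Lemma nth_write_numbers p N i : i < size (write_numbers (mkseq p N)) ->
  nth blank (write_numbers (mkseq p N)) i = input_tape p i.
Proof.
have mono d n : i < size (write_numbers (mkseq p n)) ->
    nth blank (write_numbers (mkseq p (d + n))) i = nth blank (write_numbers (mkseq p n)) i.
  move=> H; elim: d => // d <-; rewrite addSn mkseqS write_numbers_rcons nth_cat.
  rewrite ifT //; apply: leq_trans H _; elim: d => // d /leq_trans; apply.
  by rewrite addSn mkseqS write_numbers_rcons size_cat leq_addr.
move=> Hi; rewrite /input_tape.
have Hi' : i < size (write_numbers (mkseq p i.+1)).
  by apply: leq_trans (leq_size_write_numbers _); rewrite size_mkseq.
case: (leqP N i.+1) => H; first by rewrite -(mono (i.+1 - N) _ Hi) subnK.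
by rewrite -(mono (N - i.+1) _ Hi') subnK // ltnW.
Qed.

Definition offset p y := size (write_numbers (mkseq p y)).

Lemma offsetS p y : offset p y.+1 = offset p y + (p y).+1.
Proof. by rewrite /offset mkseqS write_numbers_rcons size_cat size_rcons size_nseq. Qed.

Lemma input_tape_offset p y k : k <= p y ->
  input_tape p (offset p y + k) = if k < p y then stroke else separator.
Proof.
move=> Hk; rewrite -(@nth_write_numbers p y.+1).
  rewrite mkseqS write_numbers_rcons nth_cat ltnNge leq_addr /= addKn nth_rcons size_nseq.
  by case: ltngtP Hk => // H _; rewrite nth_nseq H.
by rewrite -/(offset p y.+1) offsetS; lia.
Qed.

(** Counter 0 holds the number of separators still to be passed, counter 2 collects strokes and
    counter 1 counts the cells crossed. After skipping y numbers, counter 2 is cleared, one more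
    number is read, and counter 1 brings the input head back to cell 0. *)
Definition ask :=
  Seq (While 0 (Do (Scan 2 0 1))) (Seq (clear 2) (Seq (Do (Inc 0))
  (Seq (While 0 (Do (Scan 2 0 1))) (Seq (While 1 (Do (Back 1))) (move_reg 2 0))))).

Lemma exec_op_scan p x i m pos t :
  exec_op p (Scan 2 0 1) (Store (x .: i .: m .: zst) pos t) =
  if input_tape p pos == stroke then Store (x .: i.+1 .: m.+1 .: zst) pos.+1 t
  else Store (x.-1 .: i.+1 .: m .: zst) pos.+1 t.
Proof.
rewrite /exec_op /= act_stay.
by case: ifP => _; congr Store; apply/funext; small_reg.
Qed.

Lemma exec_scan_number p Q t c y i m s' : Q t ->
  exec p Q (While 0 (Do (Scan 2 0 1)))
    (Store (c .: i + (p y).+1 .: m + p y .: zst) (offset p y.+1) t) s' ->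
  exec p Q (While 0 (Do (Scan 2 0 1))) (Store (c.+1 .: i .: m .: zst) (offset p y) t) s'.
Proof.
move=> Qt H.
suff G k i' m' : k <= p y -> i' + k = i + p y -> m' + k = m + p y ->
    exec p Q (While 0 (Do (Scan 2 0 1)))
      (Store (c.+1 .: i' .: m' .: zst) (offset p y + (p y - k)) t) s'.
  by have := G (p y) i m (leqnn _) (erefl _) (erefl _); rewrite subnn addn0.
elim: k i' m' => [|k IH] i' m' kp Ei Em.
  apply: exec_While1 (exec_Do _) _ => //; rewrite exec_op_scan input_tape_offset subn0 ?ltnn //=.
  move: H; rewrite offsetS !addnS -Ei -Em !addn0 => H; exact: H.
apply: exec_While1 (exec_Do _) _ => //.
  by rewrite exec_op_scan; case: ifP.
rewrite exec_op_scan input_tape_offset ?leq_subr // ltn_subrL.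
rewrite (leq_trans _ kp) //= -addnS -subSn // subSS; apply: IH; lia.
Qed.

Lemma exec_ask p Q t y : Q t ->
  exec p Q ask (Store (y .: zst) 0 t) (Store (p y .: zst) 0 t).
Proof.
move=> Qt; have skip c z i m : i = offset p z ->
    exists m', exec p Q (While 0 (Do (Scan 2 0 1)))
      (Store (c .: i .: m .: zst) i t)
      (Store (0 .: offset p (z + c) .: m' .: zst) (offset p (z + c)) t).
  elim: c z i m => [|c IH] z i m ->; first by exists m; rewrite addn0; apply: exec_While0.
  have [m' Hm'] := IH z.+1 _ (m + p z) (erefl _); exists m'.
  apply: exec_scan_number => //; rewrite -offsetS -addSnnS; exact: Hm'.
have [m Hm] := skip y 0 0 0 (erefl _); rewrite add0n in Hm.
have zstE : y .: zst = y .: 0 .: 0 .: zst by apply/funext; small_reg.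
rewrite zstE; apply: exec_Seq Hm _.
apply: (@exec_Seq _ _ _ _ _ (Store (0 .: offset p y .: 0 .: zst) (offset p y) t)).
  by apply: calc_clear => //; small_reg.
apply: (@exec_Seq _ _ _ _ _ (Store (1 .: offset p y .: 0 .: zst) (offset p y) t)).
  by apply: calc_inc => //; small_reg.
apply: (@exec_Seq _ _ _ _ _ (Store (0 .: offset p y.+1 .: p y .: zst) (offset p y.+1) t)).
  by apply: exec_scan_number => //; rewrite -offsetS; apply: exec_While0.
apply: (@exec_Seq _ _ _ _ _ (Store (0 .: 0 .: p y .: zst) 0 t)).
  elim: (offset p y.+1) => [|i IH]; first exact: exec_While0.
  have E : exec_op p (Back 1) (Store (0 .: i.+1 .: p y .: zst) i.+1 t) =
           Store (0 .: i .: p y .: zst) i t.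
    by rewrite /exec_op /= act_stay; congr Store; apply/funext; small_reg.
  by apply: exec_While1 (exec_Do _) _ => //; rewrite E.
by apply: calc_move => //; small_reg.
Qed.

Definition copy_reg x y z :=
  Seq (While x (Seq (Do (Dec x)) (Seq (Do (Inc y)) (Do (Inc z))))) (move_reg z x).

Lemma calc_copy x y z r r' : x != y -> y != z -> x != z -> r z = 0 ->
  (forall j, r' j = if j == y then r y + r x else r j) -> calc (copy_reg x y z) r r'.
Proof.
move=> xy yz xz rz H.
have [[yx zy] zx] : ((y == x) = false) * ((z == y) = false) * ((z == x) = false).
  by rewrite ![_ == x]eq_sym [z == y]eq_sym !(negbTE xy, negbTE yz, negbTE xz).
pose R n j := if j == x then n else if j == y then r y + (r x - n)
  else if j == z then r x - n else r j.
pose r1 j := if j == x then 0 else if j == y then r y + r x else if j == z then r x else r j.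
apply: (@calc_seq _ _ _ r1); last first.
  apply: calc_move; rewrite ?zx // => j; rewrite H /r1 !eqxx zx zy.
  case: (eqVneq j z) => [->|jz]; first by rewrite zy.
  by case: (eqVneq j y) => [->|jy]; rewrite ?yx //; case: eqP => // ->.
suff G n r2 : r2 x = n -> (forall j, r1 j = if j == x then 0 else if j == y then r2 y + n
    else if j == z then r2 z + n else r2 j) ->
    calc (While x (Seq (Do (Dec x)) (Seq (Do (Inc y)) (Do (Inc z))))) r2 r1.
  apply: (G _ _ (erefl _)) => j; rewrite /r1 rz.
  by do 3?case: eqP.
elim: n r2 => [|n IH] r2 Ex Hr.
  apply: calc_while0 => // j; rewrite Hr !addn0.
  by do !case: eqP => [->|_] //.
pose s1 j := if j == x then n else r2 j.
pose s2 j := if j == y then (s1 j).+1 else s1 j.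
pose s3 j := if j == z then (s2 j).+1 else s2 j.
apply: (@calc_while1 _ _ _ s3); first by rewrite Ex.
  apply: (@calc_seq _ _ _ s1).
    by apply: calc_dec => j; rewrite /s1; case: eqP => // ->; rewrite Ex.
  by apply: (@calc_seq _ _ _ s2); apply: calc_inc.
apply: IH; rewrite /s3 /s2 /s1 ?(negbTE xz) ?(negbTE xy) ?eqxx // => j.
rewrite Hr (negbTE yz) zy yx zx; case: eqP => // _.
by case: eqP => [_|_]; [lia|case: eqP => // _; lia].
Qed.

Lemma zst_cons : zst = 0 .: zst.
Proof. by apply/funext; small_reg. Qed.

(** * Programs for one stage: reading one more input value, writing one output symbol *)

Section Stages.

Variable e : seq nat -> nat -> nat.
Hypothesis He : cmp (fun y : seq nat * nat => e y.1 y.2).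

(** The prefix read so far is stored in reverse, so that the next value is added by a single
    [cns]. *)
Lemma extend_ex : exists2 c, cmd_one_way c & forall p Q t j l, Q t ->
  exec p Q c (Store (j .: pickle l .: zst) 0 t)
             (Store (j .: pickle (p (size l) :: l) .: zst) 0 t).
Proof.
have [s [c oc Hc] Hs] : cmp (fun l : seq nat => size l) by cmp_tac.
exists (shift (Seq dup (Seq (shift c) (Seq (shift ask) (Seq swap cons_regs))))).
  by rewrite /= !cmd_one_way_shift oc.
move=> p Q t j l Qt.
apply: (exec_shift j (s := Store (pickle l .: zst) 0 t)
                    (s' := Store (pickle (p (size l) :: l) .: zst) 0 t)).
apply: exec_Seq (calc_dup _ _ _ Qt) _.
apply: exec_Seq (calc_shift _ (Hc _) _ _ Qt) _; rewrite Hs.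
apply: exec_Seq (exec_shift (pickle l) (exec_ask _ _ Qt)) _.
apply: exec_Seq (calc_swap _ _ _ _ Qt) _.
by rewrite pickle_consE; apply: calc_cons.
Qed.

Definition emitted (v : nat) (t : tape) : tape :=
  if v == stroke then act (stroke, Right) t
  else if v == separator then act (separator, Right) t else t.

Definition emits (v : nat) : bool := (v == stroke) || (v == separator).

(** Counter 0 follows the output head. Whether [e l j] is a stroke or a separator is computed into
    two flags that [Emit] inspects; any other value means that nothing is written. *)
Lemma emit_ex : exists2 c, cmd_one_way c & forall p (Q : tape -> Prop) t j l, Q t ->
  Q (emitted (e l j) t) ->
  exec p Q c (Store (j .: pickle l .: zst) 0 t)
             (Store (emits (e l j) + j .: pickle l .: zst) 0 (emitted (e l j) t)).
Proof.
have flag v : exists2 c, cmd_one_way c & forall l j,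
    calc c (cns (pickle l) j .: zst) (nat_of_bool (e l j == v) .: zst).
  have [g rg Hg] : cmp (fun y : seq nat * nat => e y.1 y.2 == v) by cmp_tac.
  have [c oc Hc] := rc_comp rg (rc_cns rc_hd (rc_cns rc_tl (rc_const 0))).
  exists c => // l j; have := Hc (cns (pickle l) j).
  by rewrite /= hd_cns tl_cns -[j in cns _ (cns j 0)]/(pickle j) -pickle_pairE Hg.
have [cx ox Hx] := flag stroke; have [cy oy Hy] := flag separator.
exists (Seq (Seq (copy_reg 1 2 4) (Seq (copy_reg 0 3 4) (Seq (shift (shift cons_regs))
  (Seq (shift (shift dup)) (Seq (shift (shift (shift cy))) (Seq (shift (shift swap))
  (shift (shift (shift cx)))))))))
  (Seq (Do (Emit 3 2 0)) (Seq (clear 2) (clear 3)))).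
  by rewrite /= !cmd_one_way_shift ox oy.
move=> p Q t j l Qt Qt'; pose L := pickle l; rewrite -/L.
pose x := nat_of_bool (e l j == stroke); pose y := nat_of_bool (e l j == separator).
apply: (@exec_Seq _ _ _ _ _ (Store (j .: L .: y .: x .: zst) 0 t)).
  suff: calc (Seq (copy_reg 1 2 4) (Seq (copy_reg 0 3 4) (Seq (shift (shift cons_regs))
  (Seq (shift (shift dup)) (Seq (shift (shift (shift cy))) (Seq (shift (shift swap))
  (shift (shift (shift cx))))))))) (j .: L .: zst) (j .: L .: y .: x .: zst) by apply.
  apply: (@calc_seq _ _ _ (j .: L .: L .: zst)).
    by apply: calc_copy => //; small_reg.
  apply: (@calc_seq _ _ _ (j .: L .: L .: j .: zst)).
    by apply: calc_copy => //; small_reg.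
  apply: calc_seq (calc_shift _ (calc_shift _ (calc_cons L j))) _.
  apply: calc_seq (calc_shift _ (calc_shift _ (calc_dup _))) _.
  apply: calc_seq (calc_shift _ (calc_shift _ (calc_shift _ (Hy l j)))) _.
  apply: calc_seq (calc_shift _ (calc_shift _ (calc_swap _ _))) _.
  exact: (calc_shift _ (calc_shift _ (calc_shift _ (Hx l j)))).
apply: (@exec_Seq _ _ _ _ _
  (Store (emits (e l j) + j .: L .: y .: x .: zst) 0 (emitted (e l j) t))).
  have E : exec_op p (Emit 3 2 0) (Store (j .: L .: y .: x .: zst) 0 t) =
      Store (emits (e l j) + j .: L .: y .: x .: zst) 0 (emitted (e l j) t).
    rewrite /exec_op /zeros /= /emits /emitted /x /y.
    case: (eqVneq (e l j) stroke) => _ /=; [|case: (eqVneq (e l j) separator) => _ /=];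
      rewrite ?act_stay; congr Store; by apply/funext; small_reg.
  by rewrite -E; apply: exec_Do; rewrite E.
apply: (@exec_Seq _ _ _ _ _
  (Store (emits (e l j) + j .: L .: 0 .: x .: zst) 0 (emitted (e l j) t))).
  by apply: calc_clear => //; small_reg.
by apply: calc_clear => //; small_reg.
Qed.

End Stages.

Lemma eventually_all (P : nat -> nat -> Prop) :
  (forall j, exists t0, forall t, t0 <= t -> P j t) ->
  forall J, exists t0, forall t, t0 <= t -> forall j, j < J -> P j t.
Proof.
move=> H; elim=> [|J [t0 IH]]; first by exists 0.
have [t1 H1] := H J; exists (maxn t0 t1) => t; rewrite geq_max => /andP[l0 l1] j.
by rewrite ltnS leq_eqVlt => /orP[/eqP->|]; [exact: H1|exact: IH].
Qed.

(** As [f T] and [f T.+1] differ, each stage takes at least one step, so stage k starts no earlier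
    than time k. Hence what holds throughout every stage holds at all times. *)
Lemma forever_steps C p Q (f : nat -> nat * store) :
  (forall T, reach C p Q (f T) (f T.+1)) -> (forall T, f T <> f T.+1) ->
  forall k, exists2 n, k <= n & f k = iter n (code_step C p) (f 0) /\
    forall m, m <= n -> Q (out (iter m (code_step C p) (f 0)).2).
Proof.
move=> R D; elim=> [|k [n kn [E H]]].
  by have [n _ H] := R 0; exists 0 => //; split=> // m; rewrite leqn0 => /eqP->; exact: H 0 _.
have [m Em Hm] := R k.
have m0 : 0 < m by case: m Em {Hm} => // Em; case: (D k).
exists (m + n); first by lia.
split; first by rewrite Em E iterD.
move=> i; case: (leqP i n) => [/H //|ni] imn.
by rewrite -(subnK (ltnW ni)) iterD -E; apply: Hm; lia.
Qed.

Lemma forever_out C p (Q : tape -> Prop) (f : nat -> nat * store) :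
  (forall T, reach C p Q (f T) (f T.+1)) -> (forall T, f T <> f T.+1) ->
  forall t, Q (out (iter t (code_step C p) (f 0)).2).
Proof. by move=> R D t; have [n tn [_]] := forever_steps R D t; apply. Qed.

Lemma forever_no_halt C p (f : nat -> nat * store) :
  (forall T, reach C p (fun=> True) (f T) (f T.+1)) -> (forall T, f T <> f T.+1) ->
  forall t, code_next C p (iter t (code_step C p) (f 0)) <> None.
Proof.
move=> R D t Ht.
have stuck k : iter (k + t) (code_step C p) (f 0) = iter t (code_step C p) (f 0).
  by elim: k => // k IH; rewrite addSn iterS IH /code_step Ht.
have [n tn [En _]] := forever_steps R D t.
have [m Em _] := R t.
apply: (D t); rewrite Em En -(subnK tn) stuck.
by elim: m {Em} => // m IH; rewrite iterS -IH /code_step Ht.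
Qed.

Definition seen (p : baire) (T : nat) : nat := pickle (rev (mkseq p T)).

Lemma seenS p T : seen p T.+1 = pickle (p (size (rev (mkseq p T))) :: rev (mkseq p T)).
Proof. by rewrite /seen mkseqS rev_rcons size_rev size_mkseq. Qed.

Lemma seen_neq p T : seen p T <> seen p T.+1.
Proof.
move=> /(pcan_inj pickleK) /(congr1 size).
by rewrite !size_rev !size_mkseq => /eqP; rewrite ltn_eqF.
Qed.

Lemma zst_seen p : zst = 0 .: seen p 0 .: zst.
Proof. by rewrite {1}zst_cons {1}zst_cons. Qed.

(** Input and output tapes share one notation for sequences, so [input_tape r] can serve as the
    target content of the output tape. *)
Lemma holds_at_input_tape f r n :
  (forall j, j < size (write_numbers (mkseq r n.+1)) -> f j = input_tape r j) ->
  holds_at f n (r n).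
Proof.
move=> H; exists (mkseq r n); rewrite size_mkseq; split=> //= i.
by rewrite -mkseqS => Hi; rewrite H // nth_write_numbers.
Qed.

Section OneWay.

Variable a : seq nat -> nat -> nat.
Hypothesis Ha : cmp (fun y : seq nat * nat => a y.1 y.2).

(** Cell j is determined by the first j + 1 numbers; until all of these are known the value 0 makes
    the machine wait, since a symbol once written cannot be revised. *)
Let e l j :=
  if all (fun v => v != 0) (mkseq (a (rev l)) j.+1) then
    nth blank (write_numbers (mkseq (fun n => (a (rev l) n).-1) j.+1)) j
  else 0.

Lemma computable_of_approx : exists2 M, one_way M & forall p r,
  (forall t n, a (mkseq p t) n = 0 \/ a (mkseq p t) n = (r n).+1) ->
  (forall n, exists t0, forall t, t0 <= t -> a (mkseq p t) n = (r n).+1) ->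
  forall n, exists t, output_at M p t n (r n).
Proof.
have He : cmp (fun y : seq nat * nat => e y.1 y.2).
  by rewrite /e; do 40?[cmp_step | apply: (cmp_app2 Ha)].
have [c1 o1 H1] := extend_ex; have [c2 o2 H2] := emit_ex He.
have [k k0 Hk] := cmd_bound_ex (Seq c1 c2).
(* The continuation address 0 turns the program into an endless loop, one round per stage. *)
exists (machine_of k (compile (Seq c1 c2) 0 0) 0).
  by apply: one_way_machine_of; apply: code_one_way_compile; rewrite /= o1 o2.
move=> p r a_or a_ev n; set C := compile _ _ _.
pose v T j := e (rev (mkseq p T.+1)) j.
pose st := fix st T := if T is T'.+1 then
  (emits (v T' (st T').1) + (st T').1, emitted (v T' (st T').1) (st T').2) else (0, blank_tape).
pose f T := (0, Store ((st T).1 .: seen p T .: zst) 0 (st T).2).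
have f0 : f 0 = (0, init_store) by rewrite /f /= -zst_seen.
have R T : reach C p (fun=> True) (f T) (f T.+1).
  apply: reach_exec => //; apply: exec_Seq; first exact: H1.
  by rewrite -seenS; apply: H2.
have D T : f T <> f T.+1.
  by move=> /(congr1 (fun c => regs c.2 1)); exact: seen_neq.
have vE T j : v T j = 0 \/ v T j = input_tape r j.
  rewrite /v /e revK; case: ifP => H; [right|by left].
  rewrite /input_tape; congr (nth _ (write_numbers _) _).
  apply/eq_in_map => i ij; have := allP H (a (mkseq p T.+1) i).
  by rewrite map_f // => /(_ isT); case: (a_or T.+1 i) => ->.
have vev j : exists T0, forall T, T0 <= T -> v T j = input_tape r j.
  have [T0 HT0] := eventually_all a_ev j.+1.
  exists T0 => T T0T; rewrite /v /e revK ifT.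
    rewrite /input_tape; congr (nth _ (write_numbers _) _).
    by apply/eq_in_map => i; rewrite mem_iota => /= ij; rewrite HT0 // leqW.
  by apply/allP => x /mapP[i]; rewrite mem_iota => /= ij ->; rewrite HT0 // leqW.
have inv T : Defs.head (st T).2 = (st T).1 /\
    forall i, i < (st T).1 -> cells (st T).2 i = input_tape r i.
  elim: T => //= T [hT cT]; rewrite /emits /emitted.
  case: (vE T (st T).1) => ->; first by [].
  have /orP[/eqP E|/eqP E] := input_tapeE r (st T).1; rewrite E /= hT; split=> // i;
    rewrite add1n ltnS leq_eqVlt; by case: eqP => [->|_ /cT].
have progress J : exists T, J <= (st T).1.
  elim: J => [|J [T HT]]; first by exists 0.
  have [T0 HT0] := vev (st T).1.
  (* If the output stopped growing, then at any stage from [T0] on the symbol for the current cell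
     would be known and would be written. *)
  suff [T' HT'] : exists T', (st T).1 < (st T').1 by exists T'; lia.
  apply: contrapT => /forallNP N.
  have const d : (st (d + T)).1 = (st T).1.
    elim: d => // d IH; have := N (d.+1 + T); rewrite addSn /=; lia.
  pose U := maxn T T0.
  have EU : (st U).1 = (st T).1 by rewrite -(subnK (leq_maxl T T0 : T <= U)) const.
  by apply: (N U.+1); rewrite /= EU HT0 ?leq_maxr // /emits input_tapeE add1n.
have [T HT] := progress (size (write_numbers (mkseq r n.+1))).
have [t _ [Et _]] := forever_steps R D T.
exists t.+1; apply/output_at_machine_of; first exact: code_bound_compile.
rewrite -f0 -Et; apply: holds_at_input_tape => j Hj.
by have [_ ->] := inv T => //; apply: leq_trans Hj HT.
Qed.

End OneWay.

Section LimitMachine.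

Variable a : seq nat -> nat -> nat.
Hypothesis Ha : cmp (fun y : seq nat * nat => a y.1 y.2).

(** The symbol comes from the current approximation alone. Earlier approximations may have placed
    the numbers differently, but cell j is right as soon as the first j + 1 values are final and the
    cell is rewritten. *)
Let e l j := nth blank (write_numbers (mkseq (a (rev l)) j.+1)) j.

Lemma exec_seek p (R : (nat -> nat) -> Prop) z L x h cl : R cl ->
  exec p (R \o cells) (While 2 (Do (Fwd 2 0)))
    (Store (z .: L .: x .: zst) 0 (Tape h cl)) (Store (z + x .: L .: zst) 0 (Tape (h + x) cl)).
Proof.
move=> Rcl; elim: x z h => [|x IH] z h.
  by rewrite !addn0 -zst_cons; apply: exec_While0.
have E : exec_op p (Fwd 2 0) (Store (z .: L .: x.+1 .: zst) 0 (Tape h cl)) =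
    Store (z.+1 .: L .: x .: zst) 0 (Tape h.+1 cl).
  rewrite /exec_op /=; congr Store; first by apply/funext; small_reg.
  by rewrite /act /scanned /=; congr Tape; apply/funext => i; case: eqP => // ->.
apply: exec_While1 (exec_Do _) _; rewrite ?E //.
by rewrite -!addSnnS; exact: IH.
Qed.

Lemma exec_rewind p (R : (nat -> nat) -> Prop) z L cl : R cl ->
  exec p (R \o cells) (While 0 (Do (Bwd 0)))
    (Store (z .: L .: zst) 0 (Tape z cl)) (Store (0 .: L .: zst) 0 (Tape 0 cl)).
Proof.
move=> Rcl; elim: z => [|z IH]; first exact: exec_While0.
have E : exec_op p (Bwd 0) (Store (z.+1 .: L .: zst) 0 (Tape z.+1 cl)) =
    Store (z .: L .: zst) 0 (Tape z cl).
  rewrite /exec_op /=; congr Store; first by apply/funext; small_reg.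
  by rewrite /act /scanned /=; congr Tape; apply/funext => i; case: eqP => // ->.
by apply: exec_While1 (exec_Do _) _; rewrite ?E.
Qed.

Lemma limit_computable_of_approx : exists M, forall p r,
  (forall n, exists t0, forall t, t0 <= t -> a (mkseq p t) n = r n) ->
  forall n, exists t0, forall t, t0 <= t -> output_at M p t n (r n).
Proof.
have He : cmp (fun y : seq nat * nat => e y.1 y.2).
  by rewrite /e; do 40?[cmp_step | apply: (cmp_app2 Ha)].
have [c1 _ H1] := extend_ex; have [c2 _ H2] := emit_ex He.
(* Stage T rewrites only cell [hd T]. Every j is [hd] of arbitrarily large T, so each cell is
   revised again and again. *)
have [g [c3 _ H3] Hg] : cmp (fun l : seq nat => hd (size l)).
  apply: (@cmp_comp _ _ _ hd); last exact: cmp_size (cmp_id _).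
  by exists hd; first exact: rc_hd.
pose c := Seq c1 (Seq (Seq (copy_reg 1 2 3) (shift (shift c3)))
  (Seq (While 2 (Do (Fwd 2 0))) (Seq c2 (While 0 (Do (Bwd 0)))))).
have [k k0 Hk] := cmd_bound_ex c.
exists (machine_of k (compile c 0 0) 0) => p r a_ev; set C := compile _ _ _.
pose v T j := e (rev (mkseq p T.+1)) j.
pose cl := fix cl T := if T is T'.+1 then
  fun i => if i == hd T then v T' i else cl T' i else fun=> blank.
pose f T := (0, Store (0 .: seen p T .: zst) 0 (Tape 0 (cl T))).
have f0 : f 0 = (0, init_store) by rewrite /f /= -zst_seen.
(* A stage writes a single cell once, so the tape content during the stage is the one before or the
   one after it. *)
have RR (R : (nat -> nat) -> Prop) T : R (cl T) -> R (cl T.+1) ->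
    reach C p (R \o cells) (f T) (f T.+1).
  move=> R0 R1; apply: reach_exec => //; apply: exec_Seq; first exact: H1.
  rewrite -seenS; pose j := hd T.+1.
  apply: (@exec_Seq _ _ _ _ _ (Store (0 .: seen p T.+1 .: j .: zst) 0 (Tape 0 (cl T)))).
    suff : calc (Seq (copy_reg 1 2 3) (shift (shift c3)))
        (0 .: seen p T.+1 .: zst) (0 .: seen p T.+1 .: j .: zst) by apply.
    apply: (@calc_seq _ _ _ (0 .: seen p T.+1 .: seen p T.+1 .: zst)).
      by apply: calc_copy => //; small_reg.
    have := calc_shift 0 (calc_shift (seen p T.+1) (H3 (seen p T.+1))).
    by rewrite {3}/seen Hg size_rev size_mkseq.
  apply: exec_Seq; first exact: exec_seek.
  have vE : e (rev (mkseq p T.+1)) j = v T j by [].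
  have em : emitted (v T j) (Tape j (cl T)) = Tape j.+1 (cl T.+1).
    have : (v T j == stroke) || (v T j == separator) by rewrite /v /e revK; exact: input_tapeE.
    rewrite /emitted /act /=; case: (eqVneq (v T j) stroke) => [Ev _|_ /= Ev]; rewrite ?Ev;
      congr Tape; apply/funext => i; rewrite -/j; case: eqP => // ->; rewrite ?Ev //.
    exact/esym/eqP.
  apply: (@exec_Seq _ _ _ _ _ (Store (j.+1 .: seen p T.+1 .: zst) 0 (Tape j.+1 (cl T.+1)))).
    rewrite -em; have -> : j.+1 = emits (e (rev (mkseq p T.+1)) j) + j.
      by rewrite vE /emits /v /e revK input_tapeE.
    by rewrite -vE; apply: H2; rewrite //= vE em.
  exact: exec_rewind.
have D T : f T <> f T.+1.
  by move=> /(congr1 (fun c => regs c.2 1)); exact: seen_neq.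
have cells_ev j : exists t0, forall t, t0 <= t ->
    cells (out (iter t (code_step C p) (f 0)).2) j = input_tape r j.
  have [T0 HT0] := eventually_all a_ev j.+1.
  have vr T : T0 <= T -> v T j = input_tape r j.
    move=> T0T; rewrite /v /e revK /input_tape; congr (nth _ (write_numbers _) _).
    by apply/eq_in_map => i; rewrite mem_iota => /= ij; rewrite HT0 // leqW.
  (* A stage later than [T0] at which cell j is rewritten; from then on its content is right and
     stays so. *)
  pose T1 := cns j T0; have T1_gt : T0 < T1.
    by rewrite /T1 /cns (leq_trans _ (leq_pmull _ _)) ?expn_gt0 // ltnS -addnn leq_addr.
  have T1S : T1.-1.+1 = T1 by rewrite prednK // (leq_trans _ T1_gt).
  have clT d : cl (d + T1) j = input_tape r j.
    elim: d => [|d IH]; last first.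
      by rewrite addSn /=; case: eqP => // _; apply: vr; lia.
    by rewrite add0n -T1S /= T1S hd_cns eqxx vr //; lia.
  have [n _ [En _]] := forever_steps (fun T => RR (fun=> True) T I I) D T1.
  exists n => t nt; rewrite -(subnK nt) iterD -En.
  have RT d : reach C p ((fun h => h j = input_tape r j) \o cells)
      (f (d + T1)) (f (d.+1 + T1)).
    by apply: RR; rewrite ?addSn -?addSn ?clT.
  exact: (forever_out RT (fun d => D (d + T1))).
move=> n; have [t0 Ht0] := eventually_all cells_ev (size (write_numbers (mkseq r n.+1))).
exists t0.+1 => -[//|t] t0t; apply/output_at_machine_of; first exact: code_bound_compile.
by rewrite -f0; apply: holds_at_input_tape; exact: Ht0.
Qed.

End LimitMachine.

(** * Machines with a built-in parameter and their halting *)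

Lemma pickle_machineE (M : machine) : pickle M = pickle (raw_of_machine M).
Proof.
transitivity (CodeSeq.code [:: work_tapes M; CodeSeq.code (map pickle (rules M))]); first by [].
by congr (CodeSeq.code [:: _; CodeSeq.code _]); rewrite -map_comp; apply: eq_map.
Qed.

Lemma cmp_map_seq (X T U : countType) (F : X -> T -> U) (s : seq T) :
  (forall t, cmp (fun x => F x t)) -> cmp (fun x => map (F x) s).
Proof. by move=> HF; elim: s => [|t s IH] /=; [exact: cmp_const|apply: cmp_cons]. Qed.

(* Started at address [entry C d], the code [loading C d] adds d to counter 0
   and then runs [C]. *)
Definition entry (C : code) (d : nat) := if d == 0 then 0 else size C + d.-1.

(** The loading instructions form a descending chain: each increments counter 0 and passes to the
    one before it, the last one to address 0. *)
Definition load_instr (C : code) (d : nat) := Instr (Inc 0) 0 (entry C d) (entry C d).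

Definition loading (C : code) (d : nat) := C ++ mkseq (fun j => Some (load_instr C j)) d.

Lemma nth_loading C d i : i < size C -> nth None (loading C d) i = nth None C i.
Proof. by move=> iL; rewrite nth_cat iL. Qed.

Lemma nth_loading_load C d j :
  j < d -> nth None (loading C d) (size C + j) = Some (load_instr C j).
Proof. by move=> jd; rewrite nth_cat ltnNge leq_addr /= addKn nth_mkseq. Qed.

Lemma code_bound_loading k C d : 0 < k -> code_bound k C -> code_bound k (loading C d).
Proof.
move=> k0 Ck; rewrite /code_bound all_cat -/(code_bound k _) Ck /=.
by apply/(all_nthP None) => i; rewrite size_mkseq => id; rewrite nth_mkseq //= /instr_bound /= k0.
Qed.

Lemma code_at_loading C d D : code_at C 0 D -> size D <= size C -> code_at (loading C d) 0 D.
Proof. by move=> CD sD i Hi; rewrite nth_loading ?CD // (leq_trans Hi sD). Qed.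

Lemma iter_loading C d p t j x : j <= d ->
  iter j (code_step (loading C d) p) (entry C j, Store (x .: zst) 0 t)
  = (0, Store (x + j .: zst) 0 t).
Proof.
elim: j x => [|j IH] x jd; first by rewrite addn0.
rewrite iterSr /code_step /code_next /= nth_loading_load //= /next_addr if_same.
rewrite -addSnnS -IH ?(ltnW jd) //; congr (iter _ _ (_, _)).
by rewrite /exec_op /= act_stay; congr Store; apply/funext; small_reg.
Qed.

(** An s-m-n statement. Apart from the start address, d enters only through the number of loading
    instructions, and each of these depends computably on its position. *)
Lemma cmp_loading k C :
  cmp (fun d => pickle (machine_of k (loading C d) (entry C d))).
Proof.
apply: (@cmp_ext _ _ (fun d => pickle (raw_of_machine (machine_of k (loading C d) (entry C d))))).
  by move=> d; rewrite -pickle_machineE.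
apply: cmp_pickle; rewrite /raw_of_machine.
apply: (@cmp_ext _ _ (fun d => (k,
   [seq raw_of_rule (mark_rule k (entry C d) inp) | inp <- [:: stroke; separator]] ++
   [seq raw_of_rule r | r <- code_rules k C] ++
   flatten (mkseq (fun j => [seq raw_of_rule (instr_rule (size C + j) (load_instr C j) x)
                      | x <- readings k]) d)))).
  move=> d; congr pair; rewrite [RHS]map_cat -[in RHS]map_comp; congr cat.
  rewrite /code_rules size_cat size_mkseq iotaD [in RHS]map_cat flatten_cat map_cat; congr cat.
    congr (map _ (flatten _)); apply/eq_in_map => i; rewrite mem_iota => /= iL.
    by rewrite nth_loading.
  rewrite map_flatten add0n -[X in iota X d]addn0 iotaDl -!map_comp; congr flatten.
  apply/eq_in_map => j; rewrite mem_iota => /= jd.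
  by rewrite nth_loading_load //= -map_comp.
have Hentry (X : countType) (f : X -> nat) : cmp f -> cmp (fun x => entry C (f x)).
  by move=> Hf; rewrite /entry; cmp_tac.
apply: cmp_pair; first by cmp_tac.
apply: cmp_cat; last (apply: cmp_cat; first exact: cmp_const).
  by apply: cmp_map_seq => inp; rewrite /raw_of_rule /=; do 20?[cmp_step|apply: Hentry].
apply: cmp_flatten; apply: cmp_mkseq; last exact: cmp_id.
apply: cmp_map_seq => -[[inp w] o].
by rewrite /raw_of_rule /= /next_addr /=; do 20?[cmp_step|apply: Hentry].
Qed.

Lemma code_halted_later C p c t n :
  code_next C p (iter t (code_step C p) c) = None ->
  code_next C p (iter (n + t) (code_step C p) c) = None.
Proof.
move=> H; elim: n => // n; rewrite addSn iterS; move: (iter _ _ _) => c' H'.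
by rewrite {1}/code_step H'.
Qed.

Section Search.

Variable h : nat -> nat -> bool.
Hypothesis Hh : cmp (fun y : nat * nat => h y.1 y.2).

(** The machine tries s = 0, 1, ... for the parameter d that the loading instructions have put into
    counter 0. It does not consult its input, hence the arbitrary p. *)
Lemma halting_search : exists2 g : nat -> nat, cmp g &
  forall d p, halts (nth_machine (g d)) p <-> exists s, h d s.
Proof.
have [c3 H3] : exists c3, forall d s,
    calc c3 (cns d s .: zst) (nat_of_bool (~~ h d s) .: zst).
  have [g rg Hg] : cmp (fun y : nat * nat => ~~ h y.1 y.2) by cmp_tac.
  have [c _ Hc] := rc_comp rg (rc_cns rc_hd (rc_cns rc_tl (rc_const 0))).
  exists c => d s; have := Hc (cns d s).
  rewrite /= hd_cns tl_cns -[s in cns _ (cns s 0)]/(pickle s) -[d in cns d (cns _ _)]/(pickle d).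
  by rewrite -pickle_pairE Hg.
pose B := Seq (Do (Dec 2)) (Seq (copy_reg 0 2 4) (Seq (copy_reg 1 3 4)
  (Seq (shift (shift cons_regs)) (Seq (shift (shift c3)) (Do (Inc 1)))))).
pose c := Seq (Do (Inc 2)) (While 2 B).
have HB d s : calc B (d .: s .: 1 .: zst) (d .: s.+1 .: nat_of_bool (~~ h d s) .: zst).
  apply: (@calc_seq _ _ _ (d .: s .: 0 .: zst)); first by apply: calc_dec; small_reg.
  apply: (@calc_seq _ _ _ (d .: s .: d .: zst)); first by apply: calc_copy => //; small_reg.
  apply: (@calc_seq _ _ _ (d .: s .: d .: s .: zst)); first by apply: calc_copy => //; small_reg.
  apply: calc_seq (calc_shift _ (calc_shift _ (calc_cons d s))) _.
  apply: calc_seq (calc_shift _ (calc_shift _ (H3 d s))) _.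
  by apply: calc_inc; small_reg.
have [k k0 Hk] := cmd_bound_ex c.
(* The search exits to address [cmd_size c]. The entry [None] keeps that address halting although
   loading instructions are appended behind it. *)
pose C := rcons (compile c 0 (cmd_size c)) None.
have Ck : code_bound k C by rewrite /code_bound all_rcons; exact: (code_bound_compile _ _ k0 Hk).
exists (fun d => pickle (machine_of k (loading C d) (entry C d))).
  exact: cmp_loading.
move=> d p; rewrite /nth_machine pickleK /= (halts_machine_of _ _ (code_bound_loading d k0 Ck)).
set D := loading C d; pose st s x := Store (d .: s .: x .: zst) 0 blank_tape.
have Dc : code_at D 0 (compile c 0 (cmd_size c)).
  apply: code_at_loading; last by rewrite size_rcons.
  by move=> i Hi; rewrite add0n nth_rcons Hi.
have start : iter d (code_step D p) (entry C d, init_store) = (0, st 0 0).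
  have -> : init_store = Store (0 .: zst) 0 blank_tape by rewrite -zst_cons.
  by rewrite iter_loading // /st -!zst_cons.
have inc2 : exec p (fun=> True) (Do (Inc 2)) (st 0 0) (st 0 1).
  by apply: (calc_inc (r := d .: 0 .: 0 .: zst)) => //; small_reg.
split=> [[t Ht]|[s hs]].
  apply: contrapT => /forallNP N.
  have [Dinc Dwhile] := code_at_cons Dc; have [Dtest DB] := code_at_cons Dwhile.
  have R T : reach D p (fun=> True) (1, st T 1) (1, st T.+1 1).
    apply: (reach_trans (c2 := (2, st T 1))).
      by apply: reach_step => //; rewrite (code_step_test _ _ Dtest).
    apply: (reach_exec (c := B)) => //; have := HB d T; have /negP/negbTE -> := N T; exact.
  have [n En _] : reach D p (fun=> True) (0, st 0 0) (1, st 0 1).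
    apply: (reach_exec (c := Do (Inc 2))) inc2 _ _ _ _ => //.
    by move=> [|//] _; rewrite Dinc.
  apply: (forever_no_halt R _ (t := t)).
    by move=> T /(congr1 (fun c => regs c.2 1)) /= /eqP; rewrite ltn_eqF.
  rewrite En -iterD -start -iterD -addnA [t + _]addnC.
  exact: code_halted_later.
have loop n : forall s0, h d (s0 + n) ->
    exists s', exec p (fun=> True) (While 2 B) (st s0 1) s'.
  elim: n => [|n IH] s0 hn; case hs0: (h d s0).
  - exists (st s0.+1 0); apply: exec_While1 (HB d s0 _ _ _ _ I) _ => //.
    by rewrite hs0; apply: exec_While0.
  - by rewrite addn0 hs0 in hn.
  - exists (st s0.+1 0); apply: exec_While1 (HB d s0 _ _ _ _ I) _ => //.
    by rewrite hs0; apply: exec_While0.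
  have [|s' Hs'] := IH s0.+1; first by rewrite addSnnS.
  by exists s'; apply: exec_While1 (HB d s0 _ _ _ _ I) _ => //; rewrite hs0.
have [s' Hs'] := loop s 0 hs.
have [n En _] := reach_exec (exec_Seq inc2 Hs') I Dc.
have E : nth None D (cmd_size c) = None.
  by rewrite nth_loading ?size_rcons ?size_compile // nth_rcons size_compile ltnn eqxx.
by exists (n + d); rewrite iterD start -En /code_next E.
Qed.

End Search.

(** * Reading numbers from output tapes *)

Definition read_symbol (c : nat * nat) (x : nat) : nat * nat :=
  if x == separator then (c.1.-1, c.2)
  else if c.1 == 1 then (c.1, c.2.+1) else c.

(* The first component is one more than the number of separators still to be
   skipped, and 0 once the number has been read. *)
Definition read_number (n : nat) (cs : seq nat) : nat :=
  (foldl read_symbol (n.+1, 0) cs).2.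

Lemma cmp_read_number (X : countType) (n : X -> nat) cs :
  cmp n -> cmp cs -> cmp (fun x => read_number (n x) (cs x)).
Proof. by move=> Hn Hcs; rewrite /read_number /read_symbol; cmp_tac. Qed.

Lemma write_numbers_nonblank s : all (fun x => x != blank) (write_numbers s).
Proof.
by rewrite /write_numbers; elim: s => //= n s IH; rewrite all_cat IH all_rcons all_nseq /= orbT.
Qed.

Lemma read_number_holds n m cs : holds_at (nth blank cs) n m -> read_number n cs = m.
Proof.
case=> s [sn Hw]; pose w := write_numbers (rcons s m); rewrite -/w in Hw.
(* The numbers contain no blank, whereas reading past the end of [cs] gives blanks. *)
have wcs : size w <= size cs.
  rewrite leqNgt; apply/negP => ltw; have := Hw _ ltw; rewrite nth_default // => /esym/eqP.
  by apply/negP; apply: (all_nthP blank (write_numbers_nonblank _)).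
have -> : cs = w ++ drop (size w) cs.
  rewrite -{1}(cat_take_drop (size w) cs); congr cat.
  have sw : size (take (size w) cs) = size w by rewrite size_takel.
  apply: (@eq_from_nth _ blank) => // i; rewrite sw => Hi.
  by rewrite nth_take // Hw.
rewrite /read_number foldl_cat /w write_numbers_rcons foldl_cat -sn.
have skip k a : foldl read_symbol (k.+2, a) (nseq m stroke) = (k.+2, a) by elim: (m).
have -> : foldl read_symbol ((size s).+1, 0) (write_numbers s) = (1, 0).
  elim: s {sn w Hw wcs} => //= x s IH; rewrite [write_numbers _]/(_ ++ write_numbers s).
  rewrite foldl_cat foldl_rcons.
  have -> : foldl read_symbol ((size s).+2, 0) (nseq x stroke) = ((size s).+2, 0) by elim: x.
  exact: IH.
rewrite foldl_rcons.
have -> a : foldl read_symbol (1, a) (nseq m stroke) = (1, a + m).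
  by elim: m a {w Hw wcs skip} => [|m IH] a; rewrite ?addn0 //= IH addSnnS.
rewrite add0n; have -> : read_symbol (1, m) separator = (0, m) by rewrite /read_symbol eqxx.
elim: (drop _ _) => //= x l IH.
by have -> : read_symbol (0, m) x = (0, m); [rewrite /read_symbol; case: ifP|].
Qed.

(* The output of [M] on [p] at time [size l] if [l] is a prefix of [p]. *)
Definition output_number (m : raw_machine) (n : nat) (l : seq nat) : nat :=
  read_number n (raw_run m l (size l)).2.2.

Lemma cmp_output_number (X : countType) m (n : X -> nat) l :
  cmp m -> cmp n -> cmp l -> cmp (fun x => output_number (m x) (n x) (l x)).
Proof.
move=> Hm Hn Hl; rewrite /output_number; apply: cmp_read_number => //.
by do 2!apply: cmp_snd; apply: cmp_raw_run => //; cmp_tac.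
Qed.

Lemma output_at_prefix M p t n m : output_at M p t n m <->
  output_at M (nth 0 (mkseq p t)) t n m.
Proof.
rewrite /output_at (@run_prefix M p (nth 0 (mkseq p t))) // => i it.
by rewrite nth_mkseq.
Qed.

Lemma output_numberP M l n m :
  output_at M (nth 0 l) (size l) n m -> output_number (raw_of_machine M) n l = m.
Proof.
rewrite /output_at; have [_ _ _ _ [_ ->]] := run_ok M l (size l).
exact: read_number_holds.
Qed.

Lemma output_number_mkseq M p t n m :
  output_at M p t n m -> output_number (raw_of_machine M) n (mkseq p t) = m.
Proof. by move/output_at_prefix => H; apply: output_numberP; rewrite size_mkseq. Qed.

(** Cells left of a one-way head never change, and those from the head on are still blank. A written
    number contains no blank, so it lies entirely to the left of the head. *)
Lemma output_at_one_way M p t t' n m :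
  one_way M -> t <= t' -> output_at M p t n m -> output_at M p t' n m.
Proof.
move=> oM; pose o t := output (run M p t).
have step_o u : (forall i, Defs.head (o u) <= i -> cells (o u) i = blank) ->
    [/\ Defs.head (o u) <= Defs.head (o u.+1),
        forall i, i < Defs.head (o u) -> cells (o u.+1) i = cells (o u) i &
        forall i, Defs.head (o u.+1) <= i -> cells (o u.+1) i = blank].
  move=> Hb; rewrite /o /run iterS -/(run M p u) /step -/(o u).
  case E: (current_rule _ _) => [r|] //=.
  have : r \in [seq r <- rules M | applies p (run M p u) r].
    by move: E; rewrite /current_rule; case: filter => //= ? ? [->]; rewrite mem_head.
  rewrite mem_filter => /andP[/and4P[_ _ _ /eqP ro] rM].
  rewrite -/(o u) in ro *.
  have /orP[/eqP R|/eqP R] := allP oM r rM.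
    split; rewrite /act /= ?R //= => i Hi; first by rewrite ltn_eqF.
    by rewrite gtn_eqF // Hb // ltnW.
  rewrite R ro /=; split=> // i Hi; case: eqP => [Ei|_] //; first by rewrite Ei.
    exact: Hb.
  exact: Hb.
have blanks u i : Defs.head (o u) <= i -> cells (o u) i = blank.
  by elim: u i => [//|u IH] i; have [_ _] := step_o u IH; apply.
move=> tt'; rewrite -(subnK tt'); elim: (t' - t) => // d IH /IH [s [sn Hw]].
exists s; split=> //= i Hi.
have [_ E _] := step_o (d + t) (blanks (d + t)).
rewrite -/(o _) E; first exact: Hw i Hi.
rewrite ltnNge; apply/negP => /blanks; rewrite /o (Hw i Hi) => /eqP.
by apply/negP; apply: (all_nthP blank (write_numbers_nonblank _)).
Qed.

(** * Composition with limit computable functions *)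

Section LimitOfRelative.

Variables mN mM : raw_machine.

Definition halted_by (t i : nat) : nat := if raw_halted (nth_raw i) [::] t then 1 else 0.

(* The approximation at stage [size l] to join 0' (N(x)), for a prefix [l] of x. *)
Definition join_approx (l : seq nat) : seq nat :=
  mkseq (fun i => if odd i then output_number mN i./2 l else halted_by (size l) i./2) (size l).

(** [mM] runs for as many steps as [join_approx l] has entries, so the padding by zeros does not
    influence the result. *)
Definition relative_approx (l : seq nat) (n : nat) : nat :=
  output_number mM n (join_approx l).

Lemma cmp_relative_approx : cmp (fun y : seq nat * nat => relative_approx y.1 y.2).
Proof.
rewrite /relative_approx /join_approx /halted_by.
by do 40?[cmp_step | apply: cmp_output_number | apply: cmp_raw_halted].
Qed.

End LimitOfRelative.

Lemma halted_by_jump i : exists t0, forall t, t0 <= t -> halted_by t i = halting_problem i.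
Proof.
rewrite /halted_by /halting_problem /jump nth_rawE; set M := nth_machine i.
have H t : raw_halted (raw_of_machine M) [::] t <->
    current_rule (fun=> 0) (run M (fun=> 0) t) = None.
  have E : nth 0 [::] = (fun=> 0) :> baire by apply/funext => j; rewrite nth_nil.
  by rewrite -E; exact: raw_haltedP.
case: (pselect (halts M (fun=> 0))) => [h|nh].
  rewrite asboolT //; case: h => t0 Ht0; exists t0 => t tt.
  suff : current_rule (fun=> 0) (run M (fun=> 0) t) = None by move/H ->.
  rewrite -(subnK tt); elim: (t - t0) => // d IH.
  by rewrite addSn /run iterS -/(run M _ (d + t0)) /step IH.
rewrite asboolF //; exists 0 => t _; case: ifP => // /H Ht.
by case: nh; exists t.
Qed.

Lemma limit_computable_comp F G :
  computable_relative_to halting_problem F -> limit_computable G ->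
  limit_computable (pcomp F G).
Proof.
case=> H [[M [oM HM]] FH] [N HN].
have [P HP] := limit_computable_of_approx
  (cmp_relative_approx (raw_of_machine N) (raw_of_machine M)).
exists P => x r; rewrite /pcomp; case EG: (G x) => [p|] //= EF; apply: HP => n.
have [t Ht] := HM _ _ (FH _ _ EF) n.
have ev i : exists t0, forall s, t0 <= s ->
    (if odd i then output_number (raw_of_machine N) i./2 (mkseq x s)
     else halted_by s i./2) = join halting_problem p i.
  rewrite /join; case: ifP => _; last exact: halted_by_jump.
  have [t0 Ht0] := HN _ _ EG i./2.
  by exists t0 => s /Ht0; exact: output_number_mkseq.
have [t0 Ht0] := eventually_all ev t.
exists (maxn t t0) => s; rewrite geq_max => /andP[ts t0s].
rewrite /relative_approx; set q := join_approx _ _.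
have sq : size q = s by rewrite !size_mkseq.
(* Only the first t entries of q are known to be correct. They give the right output after t steps,
   and one-wayness preserves it during the remaining steps, where wrong values may be read. *)
apply: output_numberP; rewrite sq; apply: (output_at_one_way oM ts).
rewrite /output_at (@run_prefix M _ (join halting_problem p)) // => i it.
by rewrite /q /join_approx size_mkseq nth_mkseq ?(leq_trans it) // Ht0.
Qed.

(** * Limits of event sequences *)

(* The event [cns k v] sets position k to the value v. *)
Definition last_value (l : seq nat) (k : nat) : nat :=
  foldl (fun v e => if hd e == k then tl e else v) 0 l.

Lemma last_value_cat_skip l l' j k :
  j < k -> all (fun e => k <= hd e) l' -> last_value (l ++ l') j = last_value l j.
Proof.
rewrite /last_value foldl_cat => jk; move: (foldl _ 0 l) => v.
by elim: l' v => //= e l' IH v /andP[ke /IH ->]; rewrite gtn_eqF // (leq_trans jk).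
Qed.

Lemma last_value_rcons l k v j :
  last_value (rcons l (cns k v)) j = if k == j then v else last_value l j.
Proof. by rewrite /last_value foldl_rcons hd_cns tl_cns. Qed.

Definition converges_to (q p : baire) : Prop :=
  forall k, exists t0, forall t, t0 <= t -> last_value (mkseq q t) k = p k.

Lemma converges_to_uniq q p p' : converges_to q p -> converges_to q p' -> p = p'.
Proof.
move=> H H'; apply/funext => k; have [t0 E] := H k; have [t1 E'] := H' k.
by rewrite -(E (maxn t0 t1)) ?leq_maxl // E' ?leq_maxr.
Qed.

Definition event_limit : pfun := fun q =>
  if pselect (exists p, converges_to q p) is left h then Some (projT1 (cid h)) else None.

Lemma event_limitP q p : event_limit q = Some p <-> converges_to q p.
Proof.
rewrite /event_limit; case: pselect => [h|nh]; last first.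
  by split=> // H; case: nh; exists p.
case: (cid h) => p' /= Hp'; split=> [[<-] //|H].
by rewrite (converges_to_uniq H Hp').
Qed.

Lemma cmp_hd (X : countType) (f : X -> nat) : cmp f -> cmp (fun x => hd (f x)).
Proof. by apply: cmp_comp; exists hd; first exact: rc_hd. Qed.

Lemma cmp_tl (X : countType) (f : X -> nat) : cmp f -> cmp (fun x => tl (f x)).
Proof. by apply: cmp_comp; exists tl; first exact: rc_tl. Qed.

Lemma cmp_last_value (X : countType) l (k : X -> nat) :
  cmp l -> cmp k -> cmp (fun x => last_value (l x) (k x)).
Proof.
by apply: cmp_app2; rewrite /last_value; do 30?[cmp_step | apply: cmp_hd | apply: cmp_tl].
Qed.

Lemma limit_computable_event_limit : limit_computable event_limit.
Proof.
have [M HM] := limit_computable_of_approx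
  (cmp_last_value (cmp_fst (cmp_id _)) (cmp_snd (cmp_id (seq nat * nat)%type))).
by exists M => q p /event_limitP Hq; apply: HM.
Qed.

(** * Computing from the halting problem *)

Section RelativeOfLimit.

Variable F : pfun.
Variable M : machine.
Hypothesis HM : forall p r, pcomp F event_limit p = Some r ->
  forall n, exists t0, forall t, t0 <= t -> output_at M p t n (r n).

Let m := raw_of_machine M.

Lemma converging_output q p r n : converges_to q p -> F p = Some r ->
  exists t0, forall t, t0 <= t -> output_number m n (mkseq q t) = r n.
Proof.
move=> /event_limitP qp Fp; have [|t0 H] := HM (p := q) (r := r) _ n.
  by rewrite /pcomp qp.
by exists t0 => t /H; exact: output_number_mkseq.
Qed.

Definition settled (l : seq nat) (k n : nat) : Prop :=
  forall l', all (fun e => k <= hd e) l' ->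
  output_number m n (l ++ l') = output_number m n l.

Definition agrees (l : seq nat) (k : nat) (p : baire) : Prop :=
  forall j, j < k -> last_value l j = p j.

Lemma settled_output l k n p r :
  agrees l k p -> settled l k n -> F p = Some r -> output_number m n l = r n.
Proof.
move=> lk lS Fp.
pose ev i := cns (k + i) (p (k + i)).
pose q i := if i < size l then nth 0 l i else ev (i - size l).
have qE d : mkseq q (size l + d) = l ++ mkseq ev d.
  rewrite /mkseq iotaD map_cat add0n; congr cat.
    rewrite -[RHS](mkseq_nth 0); apply/eq_in_map => i; rewrite mem_iota => /= il.
    by rewrite /q il.
  rewrite -[X in iota X d]addn0 iotaDl -map_comp; apply: eq_map => i /=.
  by rewrite /q ltnNge leq_addr /= addKn.
(* A position j < k keeps its value from l; a position j >= k is set exactly once after l, by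
   [ev (j - k)]. *)
have qp : converges_to q p.
  move=> j; exists (size l + j.+1) => t tj.
  have -> : t = size l + (t - size l) by rewrite subnKC //; lia.
  have : j < k + (t - size l) by lia.
  rewrite qE; move: (t - size l) => d; case: (ltnP j k) => [jk _|kj].
    rewrite (last_value_cat_skip _ jk) ?lk //.
    by apply/allP => e /mapP[i _ ->]; rewrite hd_cns leq_addr.
  elim: d => [|d IH]; first by rewrite addn0 ltnNge kj.
  rewrite mkseqS -rcons_cat last_value_rcons => jd.
  by case: eqP => [->//|ne]; apply: IH; lia.
have [t0 Ht0] := converging_output n qp Fp.
rewrite -(Ht0 (size l + t0)) ?leq_addl // qE lS //.
by apply/allP => e /mapP[i _ ->]; rewrite hd_cns leq_addr.
Qed.

Lemma settled_ex n p r : F p = Some r -> exists l k, agrees l k p /\ settled l k n.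
Proof.
move=> Fp; apply: contrapT => N.
(* If l does not agree with p, the empty extension is taken, so that the choice function [x] is
   total and can be used in the recursion defining [s]. *)
have ext l k : exists l', all (fun e => k <= hd e) l' /\
    (agrees l k p -> output_number m n (l ++ l') <> output_number m n l).
  case: (pselect (agrees l k p)) => [lk|]; last by exists [::].
  apply: contrapT => /forallNP N'; apply: N; exists l, k; split=> // l' Hl'.
  by apply: contrapT => ne; apply: (N' l').
pose x l k := projT1 (cid (ext l k)).
have x_all l k : all (fun e => k <= hd e) (x l k) by rewrite /x; case: cid => ? [].
have x_ne l k : agrees l k p -> output_number m n (l ++ x l k) <> output_number m n l.
  by rewrite /x; case: cid => ? [].
(* The extension chosen at stage k leaves positions below k alone, and the event at k then repairs
   position k; so [s k] agrees with p below k and is never disturbed there later. *)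
pose s := fix s k := if k is k'.+1 then rcons (s k' ++ x (s k') k') (cns k' (p k')) else [::].
have sS k : s k.+1 = rcons (s k ++ x (s k) k) (cns k (p k)) by [].
have s_size k : k <= size (s k).
  by elim: k => // k IH; rewrite sS size_rcons size_cat ltnS (leq_trans IH) ?leq_addr.
have s_agrees k : agrees (s k) k p.
  elim: k => // k IH j; rewrite sS last_value_rcons; case: eqP => [->//|ne] jk.
  have jk' : j < k by lia.
  by rewrite (last_value_cat_skip _ jk') // IH.
have s_cat k d : exists2 l, s (d + k) = s k ++ l & all (fun e => k <= hd e) l.
  elim: d => [|d [l El Hl]]; first by exists [::]; rewrite ?cats0.
  exists (rcons (l ++ x (s (d + k)) (d + k)) (cns (d + k) (p (d + k)))).
    by rewrite addSn sS {1}El -catA rcons_cat.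
  rewrite all_rcons hd_cns leq_addl all_cat Hl /=.
  by apply: sub_all (x_all _ _) => e; apply: leq_trans; rewrite leq_addl.
pose q i := nth 0 (s i.+1) i.
have qE T k : T <= size (s k) -> mkseq q T = take T (s k).
  move=> Tk; apply: (@eq_from_nth _ 0); rewrite size_mkseq ?size_takel // => i iT.
  rewrite nth_mkseq // nth_take // /q.
  have ik : i < size (s k) by apply: leq_trans Tk.
  case: (leqP i.+1 k) => H.
    have [l El _] := s_cat i.+1 (k - i.+1); rewrite subnK // in El.
    by rewrite El nth_cat s_size.
  have [l El _] := s_cat k (i.+1 - k); rewrite subnK ?(ltnW H) // in El.
  by rewrite El nth_cat ik.
have qp : converges_to q p.
  move=> j; exists (size (s j.+1)) => T sT; have [l El Hl] := s_cat j.+1 T.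
  rewrite (qE T (T + j.+1)); last by apply: leq_trans (s_size _); rewrite leq_addr.
  rewrite El take_cat ltnNge sT /= (last_value_cat_skip _ (ltnSn j)).
    exact: (s_agrees j.+1).
  by apply/allP => e /mem_take /(allP Hl).
have [t0 Ht0] := converging_output n qp Fp.
have val_prefix l : t0 <= size l -> (exists l', s t0.+1 = l ++ l') -> output_number m n l = r n.
  move=> tl_ [l' El]; rewrite -(Ht0 (size l)) // (qE _ t0.+1) El ?size_cat ?leq_addr //.
  by rewrite take_size_cat.
(* Both [s t0] and its extension are prefixes of q of length at least t0, so both would give r(n),
   against the choice of the extension. *)
apply: (x_ne _ _ (s_agrees t0)); rewrite !val_prefix //.
- by rewrite sS rcons_cat; eexists.
- by rewrite size_cat (leq_trans (s_size t0)) ?leq_addr.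
- by rewrite sS -cats1; eexists.
Qed.

(* Semidecides that [settled l k n] fails, with d = cns (pickle l) (cns k n). *)
Definition unsettled_by (d s : nat) : bool :=
  let l := CodeSeq.decode (hd d) in
  let n := tl (tl d) in
  all (fun e => hd (tl d) <= hd e) (CodeSeq.decode s) &&
  (output_number m n (l ++ CodeSeq.decode s) != output_number m n l).

Lemma cmp_unsettled_by : cmp (fun y : nat * nat => unsettled_by y.1 y.2).
Proof.
rewrite /unsettled_by.
by do 60?[cmp_step | apply: cmp_hd | apply: cmp_tl | apply: cmp_output_number].
Qed.

Lemma settledP l k n :
  settled l k n <-> ~ exists s, unsettled_by (cns (pickle l) (cns k n)) s.
Proof.
have dl (l' : seq nat) : CodeSeq.decode (pickle l') = l'.
  by rewrite -[pickle l']/(CodeSeq.code (map id l')) map_id CodeSeq.codeK.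
rewrite /unsettled_by !(hd_cns, tl_cns) dl; split=> [H [s /andP[/H ->]]|H l' Hl'].
  by rewrite eqxx.
apply/eqP/negPn/negP => ne; apply: H; exists (pickle l').
by rewrite dl Hl' ne.
Qed.

End RelativeOfLimit.

Section Certificates.

Variable m : raw_machine.
Variable g : nat -> nat.
Hypothesis Hg : cmp g.

(* For a prefix [l] of join 0' p, the number c = cns (pickle w) k certifies that
   [w] agrees with p below k and that the n-th output on [w] is settled. *)
Definition certifies (l : seq nat) (n c : nat) : bool :=
  let i := g (cns (hd c) (cns (tl c) n)) in
  [&& all (fun j => last_value (CodeSeq.decode (hd c)) j == nth 0 l (j + j).+1)
          (mkseq id (tl c)),
      (* The values p(j) with j < k sit at the indices 2j + 1 < 2k. The two bounds keep the default
         0 of [nth] from being taken for a value of p or for a negative answer of 0'. *)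
      tl c + tl c <= size l, i + i < size l & nth 0 l (i + i) == 0].

(** Certificates are tried up to the length of the prefix, so every one is eventually tried. The one
    found may change with l, which is harmless because all valid certificates give the same
    output. *)
Definition certified_output (l : seq nat) (n : nat) : nat :=
  if [seq c <- mkseq id (size l) | certifies l n c] is c :: _ then
    (output_number m n (CodeSeq.decode (hd c))).+1
  else 0.

Lemma cmp_cns (X : countType) (f h : X -> nat) : cmp f -> cmp h -> cmp (fun x => cns (f x) (h x)).
Proof.
by case=> f' rf Hf [h' rh Hh]; exists (fun n => cns (f' n) (h' n)); [exact: rc_cns|
   move=> x; rewrite Hf Hh].
Qed.

Lemma cmp_certified_output : cmp (fun y : seq nat * nat => certified_output y.1 y.2).
Proof.
rewrite /certified_output /certifies.
by do 80?[cmp_step | apply: cmp_hd | apply: cmp_tl | apply: cmp_cns | apply: cmp_last_value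
  | apply: cmp_output_number | apply: (cmp_comp Hg)].
Qed.

End Certificates.

Lemma join_even p q i : join p q (i + i) = p i.
Proof. by rewrite /join addnn odd_double doubleK. Qed.

Lemma join_odd p q i : join p q (i + i).+1 = q i.
Proof. by rewrite /join addnn /= odd_double /= uphalf_double. Qed.

Lemma computable_relative_of_comp F :
  (forall G, limit_computable G -> limit_computable (pcomp F G)) ->
  computable_relative_to halting_problem F.
Proof.
move=> /(_ _ limit_computable_event_limit)[M HM]; set m := raw_of_machine M.
have [g Hg gP] := halting_search (cmp_unsettled_by M).
have [P oP HP] := computable_of_approx (cmp_certified_output m Hg).
pose odd_part (q : baire) : baire := fun i => q (i + i).+1.
(* The domain is cut down to the sequences [join halting_problem p] with p in the domain of [F].
   This undecidable condition costs nothing, since a machine owes nothing outside the domain. *)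
exists (fun q => if `[< q = join halting_problem (odd_part q) >] then F (odd_part q) else None).
have odd_partE p : odd_part (join halting_problem p) = p.
  by apply/funext => i; rewrite /odd_part join_odd.
split; last by move=> p r Fp; rewrite odd_partE asboolT.
exists P; split=> // q r; case: asboolP => // ->; move: (odd_part q) => p.
rewrite odd_partE => Fp; set jp := join _ _.
have gE l k n : halting_problem (g (cns (pickle l) (cns k n))) = 0 <-> settled M l k n.
  by rewrite settledP -(gP _ (fun=> 0)) /halting_problem /jump; case: asboolP => h; split.
have decE (w : nat) : w = pickle (CodeSeq.decode w).
  by rewrite -[pickle _]/(CodeSeq.code (map id _)) map_id CodeSeq.decodeK.
have sound t n c : certifies g (mkseq jp t) n c ->
    output_number m n (CodeSeq.decode (hd c)) = r n.
  rewrite /certifies size_mkseq => /and4P[/allP ag kt it].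
  rewrite nth_mkseq // /jp join_even {1}(decE (hd c)) => /eqP /gE st.
  apply: (settled_output HM _ st Fp) => j jk.
  have := ag j; rewrite /mkseq map_id mem_iota jk => /(_ isT) /eqP ->.
  rewrite nth_mkseq /jp ?join_odd //; lia.
apply: HP => [t n|n].
  rewrite /certified_output; case E: filter => [|c l]; [by left|right].
  rewrite (sound t n c) //.
  by have := mem_head c l; rewrite -E mem_filter => /andP[].
have [l [k [ag st]]] := settled_ex HM n Fp.
pose c := cns (pickle l) k; pose i := g (cns (pickle l) (cns k n)).
(* The prefix must be long enough to have c among the candidates, to contain p below k, and to
   contain the answer of 0' at index 2i. *)
exists (maxn c.+1 (maxn (k + k) (i + i).+1)) => t.
rewrite !geq_max => /and3P[ct kt it].
have cert : certifies g (mkseq jp t) n c.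
  rewrite /certifies hd_cns tl_cns size_mkseq kt -/i it nth_mkseq // /jp join_even.
  move/gE: st => ->; rewrite eqxx !andbT; apply/allP => j.
  rewrite /mkseq map_id mem_iota => /= jk; rewrite nth_mkseq /jp ?join_odd; last by lia.
  have -> : CodeSeq.decode (pickle l) = l by apply: (pcan_inj pickleK); rewrite -decE.
  by rewrite ag.
rewrite /certified_output; case E: filter => [|c' l'].
  have : c \in [seq c <- mkseq id (size (mkseq jp t)) | certifies g (mkseq jp t) n c].
    by rewrite mem_filter cert size_mkseq /mkseq map_id mem_iota.
  by rewrite E.
rewrite (sound t n c') //.
by have := mem_head c' l'; rewrite -E mem_filter => /andP[].
Qed.

Theorem corollary3p3 (F : pfun) :
  computable_relative_to halting_problem F <->
  (forall G : pfun, limit_computable G -> limit_computable (pcomp F G)).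
Proof.
split=> [FH G|]; first exact: limit_computable_comp.
exact: computable_relative_of_comp.
Qed.
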